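(* Let $\sigma>0$, $-\pi/2<\theta<\pi/2$, and for $\omega,k\in\mathbb{R}$ and $\gamma\in(-\pi,\pi]$ consider the equation on $\mathbb{R}$ $$i\omega\phi=e^{i\theta}\phi''+e^{i\gamma}|\phi|^\sigma\phi+k\phi,\qquad \phi\in H^1(\mathbb{R};\mathbb{C}).\tag{$*$}$$ 1. If $\omega^2+k^2\ne0$ and $\arg(k-i\omega)\ne\theta$, then $( * )$ has at most one nontrivial solution, up to gauge rotations and translations; that is, if $\phi_1,\phi_2$ are nontrivial solutions then $\phi_2(x)=e^{i\rho}\phi_1(x-x_0)$ for some $\rho,x_0\in\mathbb{R}$. 2. Let $\omega,k\in\mathbb{R}$ be such that $\omega\cos\theta+k\sin\theta\neq0$. Define $$d=\frac{k\cos\theta-\omega\sin\theta+\sqrt{\omega^2+k^2}}{\omega\cos\theta+k\sin\theta}$$ and let $\gamma\in(-\pi,\pi]$ be the unique solution of $$\tan(\gamma-\theta)=\frac{d(\sigma+4)}{\sigma+2-2d^2},\qquad d\sin(\gamma-\theta)+\cos(\gamma-\theta)>0 .$$ Then $( * )$, with these $\theta,\omega,k,\gamma$, admits a nontrivial solution $\phi\in H^1(\mathbb{R})$ of the form $$\phi=\psi\exp(i\,d\ln\psi),$$ where $\psi>0$ is, up to scaling and scalar multiplication, the bound-state of the nonlinear Schrödinger equation.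
   Context: Solutions $\phi$ of $( * )$ are the profiles of the bound-states $u(t,x)=e^{i\omega t}\phi(x)$ of the complex Ginzburg-Landau equation $u_t=e^{i\theta}u_{xx}+e^{i\gamma}|u|^\sigma u+ku$ on $\mathbb{R}$. The argument $\arg$ takes values in $(-\pi,\pi]$. When $\sigma+2-2d^2=0$ the tangent equation is understood as $(\sigma+2-2d^2)\sin(\gamma-\theta)=d(\sigma+4)\cos(\gamma-\theta)$ (equivalently $\cos(\gamma-\theta)=0$). The bound-state of the nonlinear Schrödinger equation is the unique positive even function $Q\in H^1(\mathbb{R})$ with $Q''=Q-Q^{\sigma+1}$; ''up to scaling and scalar multiplication'' means $\psi(x)=A\,Q(Bx)$ for some constants $A,B>0$, i.e. $\psi$ is the positive even $H^1(\mathbb{R})$ solution of $\psi''=\epsilon\psi-\eta\psi^{\sigma+1}$ for some $\epsilon,\eta>0$. *)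

(* Defs.v *)
From mathcomp Require Import all_boot all_order all_algebra.
From mathcomp Require Import all_classical all_reals all_analysis.
From mathcomp Require Export complex.
Set Implicit Arguments.
Unset Strict Implicit.
Unset Printing Implicit Defensive.
Import Order.TTheory GRing.Theory Num.Theory.
Import numFieldNormedType.Exports.
Local Open Scope classical_set_scope.
Local Open Scope complex_scope.
Local Open Scope ring_scope.

Section Sobolev.
Context {R : realType}.
Implicit Types (f g : R -> R) (u v : R -> R[i]).

(* C_c^oo(R); real test functions suffice, since complex functions are tested
   componentwise below. *)
Definition test_function (eta : R -> R) : Prop :=
  (forall (n : nat) (x : R), derivable (derive1n n eta) x 1) /\
  (exists M : R, forall x : R, M < `|x| -> eta x = 0).

(* g is the derivative of f in the sense of distributions. *)
Definition weak_derivative f g : Prop :=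
  [/\ locally_integrable [set: R] f,
      locally_integrable [set: R] g
    & forall eta : R -> R, test_function eta ->
      (\int[lebesgue_measure]_x (f x * derive1 eta x))%R =
      - (\int[lebesgue_measure]_x (g x * eta x))%R].

Definition in_H1 f : Prop :=
  f \in Lfun (@lebesgue_measure R) 2%:E /\
  (exists2 g : R -> R,
     g \in Lfun (@lebesgue_measure R) 2%:E & weak_derivative f g).

Definition weak_derivativeC u v : Prop :=
  weak_derivative (fun x => complex.Re (u x)) (fun x => complex.Re (v x)) /\
  weak_derivative (fun x => complex.Im (u x)) (fun x => complex.Im (v x)).

Definition in_H1C u : Prop :=
  in_H1 (fun x => complex.Re (u x)) /\ in_H1 (fun x => complex.Im (u x)).

(* Elements of H^1 are classes of functions modulo null sets. *)
Definition nontrivial u : Prop :=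
  ~ {ae @lebesgue_measure R, forall x, u x = 0}.

End Sobolev.

Section GinzburgLandau.
Context {R : realType}.

Definition expi (t : R) : R[i] := cos t +i* sin t.

Definition modulus (z : R[i]) : R := complex.Re `|z|.

(* Principal argument, with values in (-pi, pi]; the value at z = 0 is
   irrelevant. *)
Definition arg (z : R[i]) : R :=
  let t := acos (complex.Re z / modulus z) in
  if 0 <= complex.Im z then t else - t.

(* i omega phi = e^{i theta} phi'' + e^{i gamma} |phi|^sigma phi + k phi with
   phi in H^1(R; C).  Asking for a locally integrable phi'' is no restriction:
   all the other terms of the equation are continuous functions. *)
Definition bound_state_profile (sigma theta omega k gamma : R)
    (phi : R -> R[i]) : Prop :=
  in_H1C phi /\
  (exists phi1 phi2 : R -> R[i],
    [/\ weak_derivativeC phi phi1,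
        weak_derivativeC phi1 phi2
      & {ae @lebesgue_measure R, forall x,
          'i%C * omega%:C * phi x =
          expi theta * phi2 x
          + expi gamma * (modulus (phi x) `^ sigma)%:C * phi x
          + k%:C * phi x}]).

Definition nls_bound_state (sigma : R) (Q : R -> R) : Prop :=
  [/\ forall x, 0 < Q x,
      forall x, Q (- x) = Q x,
      in_H1 Q,
      forall x, derivable Q x 1 /\ derivable (derive1 Q) x 1
    & forall x, derive1n 2 Q x = Q x - Q x `^ (sigma + 1)].

Definition dcoef (theta omega k : R) : R :=
  (k * cos theta - omega * sin theta + Num.sqrt (omega ^+ 2 + k ^+ 2))
  / (omega * cos theta + k * sin theta).

(* tan t = d (sigma + 4) / (sigma + 2 - 2 d^2); since division by zero is total
   here, the finiteness of tan t is required explicitly, and a vanishing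
   denominator means that the cross-multiplied equation holds. *)
Definition tangent_equation (sigma d t : R) : Prop :=
  if sigma + 2 - 2 * d ^+ 2 == 0 then
    (sigma + 2 - 2 * d ^+ 2) * sin t = d * (sigma + 4) * cos t
  else
    cos t != 0 /\ tan t = d * (sigma + 4) / (sigma + 2 - 2 * d ^+ 2).

Definition is_gamma (sigma theta d gamma : R) : Prop :=
  [/\ - pi < gamma <= pi,
      tangent_equation sigma d (gamma - theta)
    & 0 < d * sin (gamma - theta) + cos (gamma - theta)].

End GinzburgLandau.

(* Main.v *)
(** Dividing by [e^{i theta}], the equation reads
    [phi'' = l phi - m |phi|^sigma phi] with [l = e^{-i theta} (i omega - k)]
    and [m = e^{i (gamma - theta)}].

    Uniqueness.  Testing a weak derivative [g] of [f] against smooth cutoffs of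
    [[a, b]] gives [f b - f a = \int_a^b g] whenever [a] and [b] are Lebesgue
    points of [f]; hence [phi] is a.e. equal to a classical solution.  The
    hypothesis on [arg (k - i omega)] says that [l] is not in [ ]-oo, 0] ], so
    that [c = |l| + l] satisfies [Re c > 0] and [Re (c conj l) > 0].  If [w] is
    the difference of two solutions that are small on [[T, +oo[ ], then
    [D = Re (c w conj w')] satisfies [D' >= delta (|w|^2 + |w'|^2)] there; as [D]
    is integrable, [D <= 0], so [w T = 0] forces [D = 0] and thus [w = 0].
    Two nontrivial solutions tend to [0], so a translation and a rotation make
    them agree at such a point [T].

    Existence.  If [psi] is positive and [psi'^2] and [psi''] are the polynomials
    in [psi] and [psi^(sigma + 1)] of a soliton with parameters [eps], [eta],
    then [phi = psi^(1 + i d)] has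
    [phi'' / phi = eps (1 + i d)^2
       - eta (1 + i d) (1 + 2 i d / (sigma + 2)) psi^sigma],
    and matching both coefficients with [l] and [m] gives the formulas for [d]
    and [tan (gamma - theta)]. *)

Require Import Defs.
From mathcomp Require Import all_boot all_order all_algebra.
From mathcomp Require Import all_classical all_reals all_analysis.
From mathcomp Require Import complex.
From mathcomp Require Import measurable_realfun ring lra.
Set Implicit Arguments.
Unset Strict Implicit.
Unset Printing Implicit Defensive.
Import Order.TTheory GRing.Theory Num.Theory.
Import numFieldNormedType.Exports.
Local Open Scope classical_set_scope.
Local Open Scope complex_scope.
Local Open Scope ring_scope.

(** * Derivatives of real functions *)

(** Matching two profiles at a point equates their values but not their derivatives, so Cauchy
    uniqueness cannot be applied there. The missing data come from +oo: a small decaying solution is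
    determined by a single value, and [D] proves this without a stable manifold theorem. Since
    [Re (c conj l) = |l| (|l| + Re l)], the choice [c = |l| + l] reduces both signs required by the
    linear part to the one inequality [|l| + Re l > 0]. The nonlinear part is absorbed because
    [|phi|^sigma phi] is Lipschitz on [|phi| <= M] with a constant of order [M^sigma], even for
    [sigma < 1]. One zero of [|w|^2 + |w'|^2] then suffices, and Gronwall spreads the equality over
    the line.

    For existence, [d] is the tangent of half the argument of [l], so [(1 + i d)^2] points in the
    direction of [l]; [eps] follows from the modulus of [l], and the amplitude from [|m| = 1]. The
    tangent equation fixes [m] up to sign, and the inequality imposed on [gamma] selects the sign
    compatible with a positive amplitude. *)

(* Not a class, unlike [is_derive], so that instance resolution leaves the
   derivative in the syntactic form produced by the rules below. *)
Definition has_derive (R : realType) (f : R -> R) (x a : R) : Prop :=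
  is_derive x 1 f a.

Section Calculus.
Context {R : realType}.
Implicit Types (f g : R -> R) (x y a b : R).

Lemma has_derive_eq f x a b : has_derive f x a -> a = b -> has_derive f x b.
Proof. by move=> df <-. Qed.

Lemma has_deriveD f g x a b :
  has_derive f x a -> has_derive g x b ->
  has_derive (fun y => f y + g y) x (a + b).
Proof. by move=> df dg; exact: is_deriveD. Qed.

Lemma has_deriveB f g x a b :
  has_derive f x a -> has_derive g x b ->
  has_derive (fun y => f y - g y) x (a - b).
Proof. by move=> df dg; exact: is_deriveB. Qed.

Lemma has_deriveN f x a :
  has_derive f x a -> has_derive (fun y => - f y) x (- a).
Proof. by move=> df; exact: is_deriveN. Qed.

Lemma has_deriveM f g x a b :
  has_derive f x a -> has_derive g x b ->
  has_derive (fun y => f y * g y) x (a * g x + f x * b).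
Proof.
move=> df dg; apply: (is_derive_eq (is_deriveM df dg)).
by rewrite /GRing.scale /= addrC mulrC.
Qed.

Lemma has_derive_cst x a : has_derive (fun=> a) x 0.
Proof. exact: is_derive_cst. Qed.

Lemma has_derive_id x : has_derive (fun y => y) x 1.
Proof. exact: is_derive_id. Qed.

Lemma has_derive_comp f g x a b :
  has_derive f (g x) a -> has_derive g x b ->
  has_derive (fun y => f (g y)) x (a * b).
Proof. by move=> df dg; exact: is_derive1_comp. Qed.

Lemma has_deriveX f n x a :
  has_derive f x a ->
  has_derive (fun y => f y ^+ n.+1) x (n.+1%:R * f x ^+ n * a).
Proof.
move=> df; have -> : (fun y => f y ^+ n.+1) = f ^+ n.+1.
  by apply/funext => y; rewrite fctE.
by apply: (is_derive_eq (is_deriveX n.+1 df)).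
Qed.

Lemma has_deriveV f x a : f x != 0 ->
  has_derive f x a -> has_derive (fun y => (f y)^-1) x (- a * (f x)^-1 ^+ 2).
Proof.
move=> fx0 df; have := @is_deriveV _ f x a 1 fx0 df.
rewrite /GRing.scale /= => /is_derive_eq; apply; rewrite exprVn; ring.
Qed.

Lemma has_derive_expR f x a : has_derive f x a ->
  has_derive (fun y => expR (f y)) x (expR (f x) * a).
Proof. by move=> df; apply: has_derive_comp df; exact: is_derive_expR. Qed.

Lemma has_derive_cos f x a : has_derive f x a ->
  has_derive (fun y => cos (f y)) x (- sin (f x) * a).
Proof. by move=> df; apply: has_derive_comp df; exact: is_derive_cos. Qed.

Lemma has_derive_sin f x a : has_derive f x a ->
  has_derive (fun y => sin (f y)) x (cos (f x) * a).
Proof. by move=> df; apply: has_derive_comp df; exact: is_derive_sin. Qed.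

Lemma has_derive_shift f x c a :
  has_derive f (x + c) a -> has_derive (fun y => f (y + c)) x a.
Proof.
move=> df; rewrite -[a]mulr1; apply: (@has_derive_comp f (fun y => y + c)) => //.
by rewrite -[1]addr0; apply: has_deriveD; [exact: has_derive_id|exact: has_derive_cst].
Qed.

Lemma has_derive_reflect f x a :
  has_derive f (- x) a -> has_derive (fun y => f (- y)) x (- a).
Proof.
move=> df; rewrite -[a]mulr1 -mulrN; apply: has_derive_comp => //.
by apply: has_deriveN; exact: has_derive_id.
Qed.

Lemma has_derive_continuous f x a : has_derive f x a -> {for x, continuous f}.
Proof.
move=> df; apply: differentiable_continuous; apply/derivable1_diffP.
exact: (@ex_derive _ _ _ _ _ _ _ df).
Qed.

Lemma has_derive_derive1 f x a : has_derive f x a -> derive1 f x = a.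
Proof. by move=> df; rewrite derive1E; exact: (@derive_val _ _ _ _ _ _ _ df). Qed.

Lemma has_derive_derivable f x a : has_derive f x a -> derivable f x 1.
Proof. by move=> df; exact: (@ex_derive _ _ _ _ _ _ _ df). Qed.

Lemma derivable_has_derive f x : derivable f x 1 -> has_derive f x (derive1 f x).
Proof. by move=> df; rewrite derive1E; apply: DeriveDef. Qed.

Lemma has_derive_mvt f (f' : R -> R) a b : a <= b ->
  (forall x, a <= x <= b -> has_derive f x (f' x)) ->
  exists2 c, a <= c <= b & f b - f a = f' c * (b - a).
Proof.
move=> ab df; have [||c] := @MVT_segment R f f' a b ab.
- by move=> z; rewrite in_itv /= => /andP[az zb]; apply: df; rewrite !ltW.
- apply: continuous_in_subspaceT => z; rewrite inE /= in_itv /= => zab.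
  exact: has_derive_continuous (df _ _).
by rewrite in_itv /=; exists c.
Qed.

Lemma has_derive_ge0_le f (f' : R -> R) a b : a <= b ->
  (forall x, a <= x <= b -> has_derive f x (f' x)) ->
  (forall x, a <= x <= b -> 0 <= f' x) -> f a <= f b.
Proof.
move=> ab df f'0; have [c cab e] := has_derive_mvt ab df.
by rewrite -subr_ge0 e mulr_ge0 ?subr_ge0// f'0.
Qed.

End Calculus.

Ltac derive_rules :=
  repeat (first [ eassumption
    | apply: has_derive_cst | apply: has_derive_id
    | apply: has_deriveD | apply: has_deriveB | apply: has_deriveN
    | apply: has_deriveM | apply: has_deriveX
    | apply: has_derive_expR | apply: has_derive_cos | apply: has_derive_sin ]).
Ltac derive_tac := apply: has_derive_eq; [derive_rules | cbv beta].

(** * The nonlinearity *)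

Section PowerNonlinearity.
Context {R : realType}.
Implicit Types (p q s t a b M : R).

Lemma onem_expr_le (n : nat) s : 0 <= s <= 1 -> 1 - s ^+ n <= n%:R * (1 - s).
Proof.
move=> /andP[s0 s1]; elim: n => [|n IH]; first by rewrite expr0 subrr mul0r.
have sn : s ^+ n <= 1 by rewrite exprn_ile1.
have -> : 1 - s ^+ n.+1 = (1 - s ^+ n) + s ^+ n * (1 - s) by rewrite exprSr; ring.
rewrite -natr1 mulrDl mul1r lerD // ler_piMl // subr_ge0 //.
Qed.

(** For an integer [n.+1 >= sigma], [s^(n+1) <= s^sigma] on [0, 1], so the integer case gives the
    slope. The bound is anchored at [s = 1], hence the infinite slope of [s^sigma] at 0 for
    [sigma < 1] does no harm. *)
Lemma onem_powR_le sigma : 0 < sigma ->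
  exists2 m : R, 0 <= m & forall s, 0 <= s <= 1 -> 1 - s `^ sigma <= m * (1 - s).
Proof.
move=> sigma0; pose n := Num.bound sigma.
have sn : sigma <= n.+1%:R.
  have /ltW := archi_boundP (ltW sigma0); move/le_trans; apply.
  by rewrite ler_nat.
exists n.+1%:R => // s /andP[]; rewrite le_eqVlt => /orP[/eqP <- _|s0 s1].
  by rewrite powR0 ?gt_eqF // !subr0 mulr1 ler1n.
have s01 : 0 <= s <= 1 by rewrite (ltW s0).
rewrite (le_trans _ (onem_expr_le _ s01)) // lerD2l lerN2.
by rewrite -powR_mulrn ?(ltW s0) // ger_powR // s0.
Qed.

Definition amplitude p q : R := Num.sqrt (p ^+ 2 + q ^+ 2).

Lemma amplitude_ge0 p q : 0 <= amplitude p q.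
Proof. exact: sqrtr_ge0. Qed.

Lemma amplitude_sqr p q : amplitude p q ^+ 2 = p ^+ 2 + q ^+ 2.
Proof. by rewrite sqr_sqrtr // addr_ge0 ?sqr_ge0. Qed.

(** Order the moduli as [b <= a] and split [A z - B w = A (z - w) + (A - B) w], where [A = a^sigma]
    and [B = b^sigma]. The difference of powers multiplies the smaller vector, and
    [(A - B) b <= (A - B) a <= m A (a - b)]. As [K] does not depend on [M], the Lipschitz constant
    tends to 0 with [M]. *)
Lemma powR_nonlinearity_lipschitz sigma : 0 < sigma ->
  exists2 K : R, 0 < K & forall M p q s t,
    amplitude p q <= M -> amplitude s t <= M ->
    (amplitude p q `^ sigma * p - amplitude s t `^ sigma * s) ^+ 2 +
    (amplitude p q `^ sigma * q - amplitude s t `^ sigma * t) ^+ 2 <=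
    K * (M `^ sigma) ^+ 2 * ((p - s) ^+ 2 + (q - t) ^+ 2).
Proof.
move=> sigma0; have [m m0 Hm] := onem_powR_le sigma0.
(* The 2 comes from [|u + v|^2 <= 2 |u|^2 + 2 |v|^2], the 1 and [m ^+ 2] from the two terms of the
   splitting. *)
exists (2 * (1 + m ^+ 2)) => [|M p q s t].
  by rewrite mulr_gt0 // ltr_pwDl // sqr_ge0.
have := amplitude_sqr p q; have := amplitude_sqr s t.
have := amplitude_ge0 p q; have := amplitude_ge0 s t.
move: (amplitude p q) (amplitude s t) => a b.
wlog ab : a b p q s t / b <= a => [hw|].
  have [ba|/ltW ab] := leP b a; first exact: hw.
  move=> b0 a0 eb ea aM bM; have := hw _ _ _ _ _ _ ab a0 b0 ea eb bM aM.
  by rewrite -[_ - b `^ _ * s]opprB -[_ - b `^ _ * t]opprB -[p - s]opprB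
    -[q - t]opprB !sqrrN.
move=> b0; rewrite le_eqVlt => /orP[/eqP a0|a0] eb ea aM bM.
  have b0' : b = 0 by apply/eqP; rewrite eq_le b0 {1}a0 ab.
  move: ea eb; rewrite -a0 b0' expr0n /= => /esym/eqP.
  rewrite paddr_eq0 ?sqr_ge0 // !sqrf_eq0 => /andP[/eqP -> /eqP ->] /esym/eqP.
  rewrite paddr_eq0 ?sqr_ge0 // !sqrf_eq0 => /andP[/eqP -> /eqP ->].
  by rewrite !mulr0 subrr expr0n /= addr0 mulr0.
have := Hm (b / a); rewrite divr_ge0 ?(ltW a0) // ler_pdivrMr // mul1r.
move=> /(_ ab) hs.
have eB : b `^ sigma = a `^ sigma * (b / a) `^ sigma.
  by rewrite -powRM ?divr_ge0 ?(ltW a0)// mulrC divfK // gt_eqF.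
have A0 : 0 <= a `^ sigma by exact: powR_ge0.
have AM : a `^ sigma <= M `^ sigma.
  by rewrite ge0_ler_powR ?nnegrE ?(ltW sigma0) ?(ltW a0) // (le_trans (ltW a0)).
have BA : b `^ sigma <= a `^ sigma.
  by rewrite ge0_ler_powR ?nnegrE ?(ltW sigma0) ?(ltW a0).
have h1 : (a `^ sigma - b `^ sigma) * a <= a `^ sigma * m * (a - b).
  have -> : (a `^ sigma - b `^ sigma) * a
     = a `^ sigma * a * (1 - (b / a) `^ sigma) by rewrite eB; ring.
  have -> : a `^ sigma * m * (a - b) = a `^ sigma * a * (m * (1 - b / a)).
    by field; rewrite gt_eqF.
  by rewrite ler_wpM2l // mulr_ge0 // ltW.
move: (a `^ sigma) (b `^ sigma) A0 AM BA h1 => A B A0 AM BA h1 {eB}.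
have h2 : p * s + q * t <= a * b.
  have : (p * s + q * t) ^+ 2 <= (a * b) ^+ 2.
    rewrite [leRHS]exprMn ea eb -subr_ge0.
    have -> : (p ^+ 2 + q ^+ 2) * (s ^+ 2 + t ^+ 2) - (p * s + q * t) ^+ 2 =
      (p * t - q * s) ^+ 2 by ring.
    exact: sqr_ge0.
  have ab0 : 0 <= a * b by rewrite mulr_ge0 // ltW.
  move=> h; rewrite (le_trans (ler_norm _)) // -(ger0_norm ab0).
  by rewrite -ler_sqr ?nnegrE ?normr_ge0 // !real_normK ?num_real.
have h3 : (a - b) ^+ 2 <= (p - s) ^+ 2 + (q - t) ^+ 2.
  have -> : (p - s) ^+ 2 + (q - t) ^+ 2 =
    (p ^+ 2 + q ^+ 2) + (s ^+ 2 + t ^+ 2) - 2 * (p * s + q * t) by ring.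
  by rewrite -ea -eb; lra.
have h4 : (A - B) ^+ 2 * b ^+ 2 <= A ^+ 2 * m ^+ 2 * (a - b) ^+ 2.
  have -> : (A - B) ^+ 2 * b ^+ 2 = ((A - B) * b) ^+ 2 by ring.
  have -> : A ^+ 2 * m ^+ 2 * (a - b) ^+ 2 = (A * m * (a - b)) ^+ 2 by ring.
  have AB : 0 <= A - B by rewrite subr_ge0.
  rewrite ler_sqr ?nnegrE ?mulr_ge0 // ?subr_ge0 //.
  by rewrite (le_trans _ h1) // ler_wpM2l.
set u := (p - s) ^+ 2 + (q - t) ^+ 2 in h3 *.
have u0 : 0 <= u by rewrite addr_ge0 ?sqr_ge0.
have -> : A * p - B * s = A * (p - s) + (A - B) * s by ring.
have -> : A * q - B * t = A * (q - t) + (A - B) * t by ring.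
apply: (@le_trans _ _ (2 * (1 + m ^+ 2) * A ^+ 2 * u)).
  apply: (@le_trans _ _ (2 * A ^+ 2 * u + 2 * ((A - B) ^+ 2 * b ^+ 2))).
    rewrite eb -subr_ge0 /u.
    have -> : 2 * A ^+ 2 * ((p - s) ^+ 2 + (q - t) ^+ 2) +
        2 * ((A - B) ^+ 2 * (s ^+ 2 + t ^+ 2)) -
        ((A * (p - s) + (A - B) * s) ^+ 2 + (A * (q - t) + (A - B) * t) ^+ 2)
      = (A * (p - s) - (A - B) * s) ^+ 2 + (A * (q - t) - (A - B) * t) ^+ 2.
      by ring.
    by rewrite addr_ge0 ?sqr_ge0.
  have h5 : A ^+ 2 * m ^+ 2 * (a - b) ^+ 2 <= A ^+ 2 * m ^+ 2 * u.
    by rewrite ler_wpM2l // mulr_ge0 ?sqr_ge0.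
  have -> : 2 * (1 + m ^+ 2) * A ^+ 2 * u =
    2 * A ^+ 2 * u + 2 * (A ^+ 2 * m ^+ 2 * u) by ring.
  by rewrite lerD2l ler_wpM2l // (le_trans h4).
rewrite ler_wpM2r // ler_wpM2l ?mulr_ge0 ?addr_ge0 ?sqr_ge0 //.
by rewrite ler_sqr // nnegrE // (le_trans A0).
Qed.

End PowerNonlinearity.

(** * Differential inequalities *)

Section DifferentialInequalities.
Context {R : realType}.
Implicit Types (x y a b T B c C : R) (f g h E e S D d H : R -> R).

(** The product of [E] with [exp(- L x)] is nonincreasing. *)
Lemma gronwall_le0 E e (L : R) a b : a <= b ->
  (forall x, a <= x <= b -> has_derive E x (e x)) ->
  (forall x, a <= x <= b -> e x <= L * E x) -> E a <= 0 -> E b <= 0.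
Proof.
move=> ab dE eE Ea.
have h : - (E a * expR (- (L * a))) <= - (E b * expR (- (L * b))).
  apply: (@has_derive_ge0_le _ (fun y => - (E y * expR (- (L * y))))
    (fun y => (L * E y - e y) * expR (- (L * y))) a b ab) => y yab.
    have dEy := dE _ yab; derive_tac; ring.
  by rewrite mulr_ge0 ?expR_ge0 // subr_ge0 eE.
have : E b * expR (- (L * b)) <= 0.
  rewrite -oppr_ge0 (le_trans _ h) // oppr_ge0.
  by rewrite mulr_le0_ge0 ?expR_ge0.
by rewrite pmulr_lle0 // expR_gt0.
Qed.

Lemma primitive_unbounded H h a B c : 0 < c ->
  (forall x, a <= x -> has_derive H x (h x)) ->
  (forall x, a <= x -> c <= h x) -> (forall x, a <= x -> H x <= B) -> False.
Proof.
move=> c0 dH ch HB.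
have aB : 0 <= (B - H a + 1) / c.
  by rewrite divr_ge0 ?(ltW c0) // addr_ge0 // subr_ge0 HB.
(* At [b] the linear lower bound [H a + c (b - a)] equals [B + 1]. *)
pose b := a + (B - H a + 1) / c.
have ab : a <= b by rewrite lerDl.
have h1 : H a - c * a <= H b - c * b.
  apply: (@has_derive_ge0_le _ (fun y => H y - c * y) (fun y => h y - c) a b ab).
    by move=> y /andP[ay _]; have dHy := dH _ ay; derive_tac; ring.
  by move=> y /andP[ay _]; rewrite subr_ge0 ch.
have := HB b ab; apply/negP; rewrite -ltNge.
have : c * b = c * a + B - H a + 1 by rewrite /b; field; rewrite gt_eqF.
by move: h1; lra.
Qed.

(* The increments of [g] are dominated by those of the convergent function [H]. *)
Lemma dominated_vanishes g dg H h B :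
  (forall x, 0 <= x -> has_derive g x (dg x)) ->
  (forall x, 0 <= x -> has_derive H x (h x)) ->
  (forall x, 0 <= x -> - h x <= dg x) -> (forall x, 0 <= x -> 0 <= g x <= h x) ->
  (forall x, 0 <= x -> H x <= B) ->
  forall eps : R, 0 < eps -> exists2 T, 0 <= T & forall x, T <= x -> g x <= eps.
Proof.
move=> dg' dH hdg gh HB eps eps0.
pose A := [set H x | x in [set x | 0 <= x]].
have supA : has_sup A.
  split; first by exists (H 0); exists 0 => /=.
  by exists B => _ [x /= x0 <-]; exact: HB.
have [_ [T /= T0 <-] HT] := sup_adherent (divr_gt0 eps0 (ltr0n R 2)) supA.
have Hle x : 0 <= x -> H x <= sup A.
  by move=> x0; apply: ub_le_sup; [case: supA|exists x].
exists T => // x Tx; rewrite leNgt; apply/negP => gx.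
(* [g + H] is nondecreasing, and past [T] the function [H] can gain at most [eps / 2]. If
   [g x > eps], then [g] never falls below [eps / 2] again, and [H] grows without bound. *)
have gy y : x <= y -> eps / 2 <= g y.
  move=> xy.
  have hh : g x + H x <= g y + H y.
    apply: (@has_derive_ge0_le _ (fun y => g y + H y) (fun y => dg y + h y)) => //.
      move=> z /andP[xz _].
      have z0 : 0 <= z by rewrite (le_trans _ xz) // (le_trans T0).
      by apply: has_deriveD; [exact: dg'|exact: dH].
    move=> z /andP[xz _]; rewrite -lerBlDr sub0r hdg //.
    by rewrite (le_trans _ xz) // (le_trans T0).
  have HTx : H T <= H x.
    apply: (@has_derive_ge0_le _ H h) => // z /andP[Tz _].
      by apply: dH; rewrite (le_trans T0).
    by have /andP[z1 z2] := gh z (le_trans T0 Tz); exact: le_trans z2.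
  have := Hle y; rewrite (le_trans T0) ?(le_trans Tx) // => /(_ isT) Hy.
  by move: HT HTx Hy hh gx; lra.
have x0 : 0 <= x by exact: le_trans Tx.
apply: (@primitive_unbounded H h x B (eps / 2)) => [|y xy|y xy|y xy].
- by rewrite divr_gt0.
- by apply: dH; rewrite (le_trans x0).
- apply: le_trans (gy _ xy) _.
  by have /andP[] := gh y (le_trans x0 xy).
- by apply: HB; rewrite (le_trans x0).
Qed.

(* [D] increases and, being dominated by an integrable function, cannot become
   positive. *)
Lemma cone_vanishes D d S H h T B c C : 0 < c -> 0 < C ->
  (forall x, T <= x -> has_derive D x (d x)) ->
  (forall x, T <= x -> has_derive H x (h x)) ->
  (forall x, T <= x -> 0 <= S x) ->
  (forall x, T <= x -> c * S x <= d x) -> (forall x, T <= x -> D x <= C * S x) ->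
  (forall x, T <= x -> S x <= h x) -> (forall x, T <= x -> H x <= B) ->
  0 <= D T -> exists2 x, T <= x & S x = 0.
Proof.
move=> c0 C0 dD dH S0 Sd DS Sh HB DT.
have Dmono x y : T <= x -> x <= y -> D x <= D y.
  move=> Tx xy; apply: (has_derive_ge0_le xy) => z /andP[xz _].
    by apply: dD; rewrite (le_trans Tx).
  have Tz := le_trans Tx xz.
  by apply: le_trans (Sd _ Tz); rewrite mulr_ge0 ?(ltW c0) // S0.
have D0 x : T <= x -> D x = 0.
  move=> Tx; apply/eqP; rewrite eq_le (le_trans DT (Dmono _ _ _ _)) // andbT.
  rewrite leNgt; apply/negP => Dx.
  apply: (@primitive_unbounded H h x B (D x / C)) => [|y xy|y xy|y xy].
  - by rewrite divr_gt0.
  - by apply: dH; rewrite (le_trans Tx).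
  - have Ty := le_trans Tx xy.
    apply: le_trans (Sh _ Ty); rewrite ler_pdivrMr // mulrC.
    by apply: le_trans (DS _ Ty); exact: Dmono.
  - by apply: HB; rewrite (le_trans Tx).
(* [D] is constant, so its derivative vanishes at some point of [T, T + 1], and there it dominates
   [c * S]. *)
have T1 : T <= T + 1 by rewrite lerDl.
have [|x /andP[Tx _]] := @has_derive_mvt _ D d T (T + 1) T1.
  by move=> z /andP[Tz _]; exact: dD.
rewrite !D0 // subrr addrAC subrr add0r mulr1 => dx.
exists x => //; apply/eqP; rewrite eq_le S0 // andbT.
by have := Sd x Tx; rewrite -dx pmulr_rle0.
Qed.

End DifferentialInequalities.

(** * Uniqueness for the profile equation *)

Section ProfileSystem.
Context {R : realType} (sigma : R) (l1 l2 m1 m2 : R).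
Implicit Types (x y a b c T B M : R) (p q s t u v H : R -> R).

(* With phi = p + i q, l = l1 + i l2 and m = m1 + i m2, this is
   phi'' = l phi - m |phi|^sigma phi as a first order system. *)
Definition profile_system p q p' q' : Prop := forall x,
  [/\ has_derive p x (p' x), has_derive q x (q' x),
      has_derive p' x (l1 * p x - l2 * q x -
        amplitude (p x) (q x) `^ sigma * (m1 * p x - m2 * q x))
    & has_derive q' x (l2 * p x + l1 * q x -
        amplitude (p x) (q x) `^ sigma * (m2 * p x + m1 * q x))].

Definition energy p q p' q' x : R :=
  p x ^+ 2 + q x ^+ 2 + p' x ^+ 2 + q' x ^+ 2.

(** A bounded primitive on the right half-line stands for integrability of the energy; the
    comparison argument takes from H^1 only this. *)
Definition finite_energy p q p' q' : Prop :=
  exists H B, forall x, 0 <= x ->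
    has_derive H x (energy p q p' q' x) /\ H x <= B.

Lemma energy_ge0 p q p' q' x : 0 <= energy p q p' q' x.
Proof. by rewrite /energy !addr_ge0 ?sqr_ge0. Qed.

Lemma energy_eq0 p q p' q' x : energy p q p' q' x = 0 ->
  [/\ p x = 0, q x = 0, p' x = 0 & q' x = 0].
Proof.
rewrite /energy => /eqP; rewrite !paddr_eq0 ?addr_ge0 ?sqr_ge0 // !sqrf_eq0.
by move=> /andP[/andP[/andP[/eqP -> /eqP ->] /eqP ->] /eqP ->].
Qed.

Lemma amplitude_le (p q M : R) : 0 <= M -> p ^+ 2 + q ^+ 2 <= M ^+ 2 ->
  amplitude p q <= M.
Proof.
by move=> M0 h; rewrite -(ger0_norm M0) -sqrtr_sqr ler_sqrt // sqr_ge0.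
Qed.

Lemma amplitude_rotate (c d p q : R) : c ^+ 2 + d ^+ 2 = 1 ->
  amplitude (c * p - d * q) (d * p + c * q) = amplitude p q.
Proof.
move=> cd; congr Num.sqrt.
have -> : (c * p - d * q) ^+ 2 + (d * p + c * q) ^+ 2 =
  (c ^+ 2 + d ^+ 2) * (p ^+ 2 + q ^+ 2) by ring.
by rewrite cd mul1r.
Qed.

Lemma profile_system0 : 0 < sigma ->
  profile_system (fun=> 0) (fun=> 0) (fun=> 0) (fun=> 0).
Proof.
move=> s0 x; split; try exact: has_derive_cst.
all: by rewrite !(mulr0, subr0, addr0); exact: has_derive_cst.
Qed.

Lemma profile_system_shift c p q p' q' : profile_system p q p' q' ->
  profile_system (fun x => p (x + c)) (fun x => q (x + c))
    (fun x => p' (x + c)) (fun x => q' (x + c)).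
Proof.
by move=> h x; have [? ? ? ?] := h (x + c); split; exact: has_derive_shift.
Qed.

Lemma profile_system_reflect p q p' q' : profile_system p q p' q' ->
  profile_system (fun x => p (- x)) (fun x => q (- x))
    (fun x => - p' (- x)) (fun x => - q' (- x)).
Proof.
move=> h x; have [? ? d1 d2] := h (- x); split; try exact: has_derive_reflect.
- by rewrite -[X in has_derive _ _ X]opprK; apply/has_deriveN/has_derive_reflect.
- by rewrite -[X in has_derive _ _ X]opprK; apply/has_deriveN/has_derive_reflect.
Qed.

Lemma profile_system_rotate c d p q p' q' : c ^+ 2 + d ^+ 2 = 1 ->
  profile_system p q p' q' ->
  profile_system (fun x => c * p x - d * q x) (fun x => d * p x + c * q x)
    (fun x => c * p' x - d * q' x) (fun x => d * p' x + c * q' x).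
Proof.
move=> cd h x; have [? ? ? ?] := h x; rewrite amplitude_rotate //.
by split; derive_tac; ring.
Qed.

Lemma finite_energy_shift c p q p' q' : 0 <= c -> finite_energy p q p' q' ->
  finite_energy (fun x => p (x + c)) (fun x => q (x + c))
    (fun x => p' (x + c)) (fun x => q' (x + c)).
Proof.
move=> c0 [H [B HB]]; exists (fun x => H (x + c)), B => x x0.
have [|dH HBx] := HB (x + c); first by rewrite addr_ge0.
by split => //; exact: has_derive_shift.
Qed.

Lemma finite_energy_rotate c d p q p' q' : c ^+ 2 + d ^+ 2 = 1 ->
  finite_energy p q p' q' ->
  finite_energy (fun x => c * p x - d * q x) (fun x => d * p x + c * q x)
    (fun x => c * p' x - d * q' x) (fun x => d * p' x + c * q' x).
Proof.
move=> cd [H [B HB]]; exists H, B => x /HB[dH HBx]; split => //.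
apply: has_derive_eq dH _; rewrite /energy.
have -> : (c * p x - d * q x) ^+ 2 + (d * p x + c * q x) ^+ 2 +
    (c * p' x - d * q' x) ^+ 2 + (d * p' x + c * q' x) ^+ 2 =
  (c ^+ 2 + d ^+ 2) * (p x ^+ 2 + q x ^+ 2 + p' x ^+ 2 + q' x ^+ 2) by ring.
by rewrite cd mul1r.
Qed.

Lemma finite_energy0 : finite_energy (fun=> 0) (fun=> 0) (fun=> 0) (fun=> 0).
Proof.
exists (fun=> 0), 0 => x _; split => //; rewrite /energy expr0n /= !addr0.
exact: has_derive_cst.
Qed.

(** Completing squares gives [(|phi|^2)' >= - (|phi|^2 + |phi'|^2)], which is the domination
    required by [dominated_vanishes]. *)
Lemma finite_energy_vanishes p q p' q' : profile_system p q p' q' ->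
  finite_energy p q p' q' -> forall eps : R, 0 < eps ->
  exists2 T, 0 <= T & forall x, T <= x -> p x ^+ 2 + q x ^+ 2 <= eps.
Proof.
move=> ode [H [B HB]].
apply: (@dominated_vanishes R (fun x => p x ^+ 2 + q x ^+ 2)
  (fun x => 2 * p x * p' x + 2 * q x * q' x) H (energy p q p' q') B).
- by move=> x _; have [? ? _ _] := ode x; derive_tac; ring.
- by move=> x /HB[].
- move=> x _; rewrite -subr_ge0 opprK /energy.
  have -> : 2 * p x * p' x + 2 * q x * q' x +
      (p x ^+ 2 + q x ^+ 2 + p' x ^+ 2 + q' x ^+ 2) =
    (p x + p' x) ^+ 2 + (q x + q' x) ^+ 2 by ring.
  by rewrite addr_ge0 ?sqr_ge0.
- move=> x _; rewrite addr_ge0 ?sqr_ge0 //= /energy -addrA lerDl.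
  by rewrite addr_ge0 ?sqr_ge0.
- by move=> x /HB[].
Qed.

End ProfileSystem.

(** * Cauchy uniqueness and comparison of decaying solutions *)

Section ProfileUniqueness.
Context {R : realType} (sigma : R) (l1 l2 m1 m2 : R).
Hypothesis sigma_gt0 : 0 < sigma.
Implicit Types (x y a b c T B M : R) (p q s t u v H : R -> R).
Local Notation profile_system := (profile_system sigma l1 l2 m1 m2).

Lemma profile_system_uniq_right p q p' q' s t s' t' a :
  profile_system p q p' q' -> profile_system s t s' t' ->
  [/\ p a = s a, q a = t a, p' a = s' a & q' a = t' a] ->
  forall b, a <= b -> p b = s b /\ q b = t b.
Proof.
move=> ode1 ode2 [pa qa p'a q'a] b ab.
have [K K0 HK] := powR_nonlinearity_lipschitz sigma_gt0.
(* The nonlinearity is only locally Lipschitz; the maximum of [g] on [a, b] bounds both amplitudes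
   there by a common [M]. *)
pose g x := p x ^+ 2 + q x ^+ 2 + (s x ^+ 2 + t x ^+ 2).
have g0 x : 0 <= g x by rewrite /g !addr_ge0 ?sqr_ge0.
have [|c cab gc] := @EVT_max R g a b ab.
  apply: continuous_in_subspaceT => x _.
  have [? ? _ _] := ode1 x; have [? ? _ _] := ode2 x.
  by apply: (@has_derive_continuous _ _ _ _); derive_rules.
pose M := Num.sqrt (g c).
have gM x : a <= x <= b -> g x <= M ^+ 2.
  by move=> xab; rewrite sqr_sqrtr // gc // in_itv.
pose w1 x := p x - s x; pose w2 x := q x - t x.
pose v1 x := p' x - s' x; pose v2 x := q' x - t' x.
pose n1 x := amplitude (p x) (q x) `^ sigma * p x -
  amplitude (s x) (t x) `^ sigma * s x.
pose n2 x := amplitude (p x) (q x) `^ sigma * q x -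
  amplitude (s x) (t x) `^ sigma * t x.
pose z1 x := l1 * w1 x - l2 * w2 x - (m1 * n1 x - m2 * n2 x).
pose z2 x := l2 * w1 x + l1 * w2 x - (m2 * n1 x + m1 * n2 x).
pose k := K * (M `^ sigma) ^+ 2.
have nw x : a <= x <= b -> n1 x ^+ 2 + n2 x ^+ 2 <= k * (w1 x ^+ 2 + w2 x ^+ 2).
  move=> xab; have gx := gM x xab; apply: HK.
  - apply: amplitude_le; first exact: sqrtr_ge0.
    by apply: le_trans gx; rewrite lerDl addr_ge0 ?sqr_ge0.
  - apply: amplitude_le; first exact: sqrtr_ge0.
    by apply: le_trans gx; rewrite lerDr addr_ge0 ?sqr_ge0.
pose E := energy w1 w2 v1 v2.
pose e x := 2 * (w1 x * v1 x + w2 x * v2 x + v1 x * z1 x + v2 x * z2 x).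
(* Bound [2 w.v] and [2 v.z] by sums of squares, then use [|z|^2 <= 2 |l|^2 |w|^2 + 2 |m|^2 |n|^2]
   and [|n|^2 <= k |w|^2]. *)
pose L := 2 + 2 * (l1 ^+ 2 + l2 ^+ 2) + 2 * (m1 ^+ 2 + m2 ^+ 2) * k.
have Eb : E b <= 0.
  apply: (@gronwall_le0 R E e L a b ab) => [x xab|x xab|].
  - have [? ? ? ?] := ode1 x; have [? ? ? ?] := ode2 x.
    rewrite /E /energy /w1 /w2 /v1 /v2; derive_tac.
    rewrite /e /z1 /z2 /n1 /n2 /w1 /w2 /v1 /v2; ring.
  - have kn := nw x xab; rewrite /e /L /E /energy /z1 /z2.
    move: (w1 x) (w2 x) (v1 x) (v2 x) (n1 x) (n2 x) kn => a1 a2 b1 b2 c1 c2 kn.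
    set d1 := _ - (m1 * c1 - m2 * c2); set d2 := _ - (m2 * c1 + m1 * c2).
    have h1 := sqr_ge0 (a1 - b1); have h2 := sqr_ge0 (a2 - b2).
    have h3 := sqr_ge0 (b1 - d1); have h4 := sqr_ge0 (b2 - d2).
    have h5 : d1 ^+ 2 + d2 ^+ 2 <= 2 * (l1 ^+ 2 + l2 ^+ 2) * (a1 ^+ 2 + a2 ^+ 2)
        + 2 * (m1 ^+ 2 + m2 ^+ 2) * (c1 ^+ 2 + c2 ^+ 2).
      rewrite -subr_ge0 /d1 /d2.
      set A := (X in 0 <= X).
      have -> : A = (l1 * a1 - l2 * a2 + (m1 * c1 - m2 * c2)) ^+ 2 +
         (l2 * a1 + l1 * a2 + (m2 * c1 + m1 * c2)) ^+ 2 by rewrite /A; ring.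
      by rewrite addr_ge0 ?sqr_ge0.
    have h6 : 2 * (m1 ^+ 2 + m2 ^+ 2) * (c1 ^+ 2 + c2 ^+ 2) <=
        2 * (m1 ^+ 2 + m2 ^+ 2) * (k * (a1 ^+ 2 + a2 ^+ 2)).
      by rewrite ler_wpM2l // mulr_ge0 // addr_ge0 ?sqr_ge0.
    have k0 : 0 <= k by rewrite mulr_ge0 ?sqr_ge0 ?ltW.
    have h7 : 0 <= (2 * (l1 ^+ 2 + l2 ^+ 2) + 2 * (m1 ^+ 2 + m2 ^+ 2) * k) *
        (b1 ^+ 2 + b2 ^+ 2).
      have l0 : 0 <= l1 ^+ 2 + l2 ^+ 2 by rewrite addr_ge0 ?sqr_ge0.
      have m0 : 0 <= m1 ^+ 2 + m2 ^+ 2 by rewrite addr_ge0 ?sqr_ge0.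
      apply: mulr_ge0; last by rewrite addr_ge0 ?sqr_ge0.
      by rewrite addr_ge0 ?(mulr_ge0 _ k0) ?mulr_ge0.
    have h8 := sqr_ge0 a1; have h9 := sqr_ge0 a2.
    move: h1 h2 h3 h4 h5 h6 h7 h8 h9; lra.
  - by rewrite /E /energy /w1 /w2 /v1 /v2 pa qa p'a q'a !subrr expr0n /= !addr0.
have /energy_eq0[/eqP w1b /eqP w2b _ _] : E b = 0.
  by apply/eqP; rewrite eq_le Eb energy_ge0.
by split; apply/eqP; rewrite -subr_eq0.
Qed.

Lemma profile_system_uniq p q p' q' s t s' t' a :
  profile_system p q p' q' -> profile_system s t s' t' ->
  [/\ p a = s a, q a = t a, p' a = s' a & q' a = t' a] ->
  forall x, p x = s x /\ q x = t x.
Proof.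
move=> ode1 ode2 ha x; have [ax|/ltW xa] := leP a x.
  exact: (profile_system_uniq_right ode1 ode2 ha).
have := @profile_system_uniq_right _ _ _ _ _ _ _ _ (- a)
  (profile_system_reflect ode1) (profile_system_reflect ode2).
case: ha => h1 h2 h3 h4; rewrite /= !opprK h1 h2 h3 h4.
by move=> /(_ (And4 erefl erefl erefl erefl) (- x)); rewrite opprK lerN2; apply.
Qed.

(* [l] avoids the half-line ]-oo, 0] *)
Let r := Num.sqrt (l1 ^+ 2 + l2 ^+ 2).
Hypothesis spectral_gap : 0 < r + l1.

(** Only the values agree at [T]; finite energy at +oo replaces the condition on the derivatives.
    The bound [M] is chosen so small that the nonlinear term consumes only part of the coercive term
    [rho |w|^2]. *)
Lemma small_amplitude_uniq : exists2 M, 0 < M &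
  forall p q p' q' s t s' t' T, 0 <= T ->
  profile_system p q p' q' -> profile_system s t s' t' ->
  finite_energy p q p' q' -> finite_energy s t s' t' ->
  (forall x, T <= x -> amplitude (p x) (q x) <= M) ->
  (forall x, T <= x -> amplitude (s x) (t x) <= M) ->
  p T = s T -> q T = t T -> forall x, p x = s x /\ q x = t x.
Proof.
have [K K0 HK] := powR_nonlinearity_lipschitz sigma_gt0.
have r0 : 0 <= r by exact: sqrtr_ge0.
have rr : r ^+ 2 = l1 ^+ 2 + l2 ^+ 2 by rewrite sqr_sqrtr // addr_ge0 ?sqr_ge0.
have rgt0 : 0 < r.
  rewrite lt_def r0 andbT; apply/eqP => r_eq0; move: spectral_gap rr.
  rewrite r_eq0 add0r expr0n /= => l1gt0 /eqP.
  by rewrite eq_sym paddr_eq0 ?sqr_ge0 // !sqrf_eq0 gt_eqF.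
(* the multiplier [k] satisfies Re k > 0 and Re (k conj l) > 0 *)
pose k1 := r + l1; pose k2 := l2; pose rho := r * k1.
have k10 : 0 < k1 by [].
have rho0 : 0 < rho by rewrite mulr_gt0.
pose kk := k1 ^+ 2 + k2 ^+ 2; pose mm := m1 ^+ 2 + m2 ^+ 2.
have kk0 : 0 < kk by rewrite ltr_pwDl ?sqr_ge0 // exprn_gt0.
have mm0 : 0 <= mm by rewrite addr_ge0 ?sqr_ge0.
(* [eta] is the future value of [M^sigma]. The cap 1 gives [eta^2 <= eta], the other bound gives
   [kapE], and [mm + 1] keeps the denominator positive when [m = 0]. *)
pose eta := Num.min 1 (rho ^+ 2 / 2 / (kk * (mm + 1) * K)).
have den0 : 0 < kk * (mm + 1) * K by rewrite !mulr_gt0 // ltr_wpDl.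
have eta0 : 0 < eta by rewrite lt_min ltr01 /= !divr_gt0 // exprn_gt0.
pose M := eta `^ (sigma^-1).
have Ms : M `^ sigma = eta.
  by rewrite /M -powRrM mulVf ?gt_eqF // powRr1 // ltW.
exists M; first exact: powR_gt0.
pose kap := K * (M `^ sigma) ^+ 2.
have kapE : kk * mm * kap <= rho ^+ 2 / 2.
  have h1 : eta ^+ 2 <= rho ^+ 2 / 2 / (kk * (mm + 1) * K).
    apply: (@le_trans _ _ eta); last by rewrite ge_min lexx orbT.
    by rewrite expr2 ler_piMl ?(ltW eta0) // ge_min lexx.
  move: h1; rewrite ler_pdivlMr // => h1; apply: le_trans h1.
  rewrite /kap Ms.
  have -> : eta ^+ 2 * (kk * (mm + 1) * K) =
    kk * mm * (K * eta ^+ 2) + kk * K * eta ^+ 2 by ring.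
  by rewrite lerDl !mulr_ge0 ?sqr_ge0 ?ltW.
move=> p q p' q' s t s' t' T T0 ode1 ode2 [H1 [B1 HB1]] [H2 [B2 HB2]] pM sM pT qT.
pose w1 x := p x - s x; pose w2 x := q x - t x.
pose v1 x := p' x - s' x; pose v2 x := q' x - t' x.
pose n1 x := amplitude (p x) (q x) `^ sigma * p x -
  amplitude (s x) (t x) `^ sigma * s x.
pose n2 x := amplitude (p x) (q x) `^ sigma * q x -
  amplitude (s x) (t x) `^ sigma * t x.
have nw x : T <= x -> n1 x ^+ 2 + n2 x ^+ 2 <= kap * (w1 x ^+ 2 + w2 x ^+ 2).
  by move=> Tx; apply: HK; [exact: pM|exact: sM].
pose D x := (k1 * w1 x - k2 * w2 x) * v1 x + (k1 * w2 x + k2 * w1 x) * v2 x.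
pose N1 x := m1 * n1 x - m2 * n2 x; pose N2 x := m2 * n1 x + m1 * n2 x.
pose d x := k1 * (v1 x ^+ 2 + v2 x ^+ 2) + rho * (w1 x ^+ 2 + w2 x ^+ 2) -
  ((k1 * w1 x - k2 * w2 x) * N1 x + (k1 * w2 x + k2 * w1 x) * N2 x).
pose S := energy w1 w2 v1 v2.
(* The energy of a difference is at most twice the sum of the energies. *)
pose h x := 2 * energy p q p' q' x + 2 * energy s t s' t' x.
have T_ge0 x : T <= x -> 0 <= x by exact: le_trans.
(* [rho / 4] is what the nonlinear term, bounded by [3 / 4 * rho * |w|^2], leaves of [rho |w|^2].
   The constant [kk + 1] comes from [2 Re (k w conj w') <= kk |w|^2 + |w'|^2]. *)
have [||||||||||x Tx] := @cone_vanishes R D d S (fun x => 2 * H1 x + 2 * H2 x) h T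
  (2 * B1 + 2 * B2) (Num.min k1 (rho / 4)) (kk + 1).
- by rewrite lt_min k10 divr_gt0.
- by rewrite ltr_wpDl // ltW.
- move=> x _; have [? ? ? ?] := ode1 x; have [? ? ? ?] := ode2 x.
  rewrite /D /w1 /w2 /v1 /v2; derive_tac.
  rewrite /d /N1 /N2 /n1 /n2 /w1 /w2 /v1 /v2.
  have -> : rho = k1 * l1 + k2 * l2.
    by rewrite /rho /k1 /k2 mulrDl -!expr2 -addrA -rr; ring.
  ring.
- move=> x /T_ge0 x0; have [? _] := HB1 x x0; have [? _] := HB2 x x0.
  derive_tac; rewrite /h; ring.
- by move=> x _; exact: energy_ge0.
- move=> x Tx; have nwx := nw x Tx; rewrite /S /energy /d /N1 /N2.
  move: (w1 x) (w2 x) (v1 x) (v2 x) (n1 x) (n2 x) nwx => a1 a2 b1 b2 c1 c2 nwx.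
  set e1 := k1 * a1 - _; set e2 := k1 * a2 + _.
  set f1 := m1 * c1 - _; set f2 := m2 * c1 + _.
  have ee : e1 ^+ 2 + e2 ^+ 2 = kk * (a1 ^+ 2 + a2 ^+ 2).
    by rewrite /e1 /e2 /kk; ring.
  have ff : f1 ^+ 2 + f2 ^+ 2 = mm * (c1 ^+ 2 + c2 ^+ 2).
    by rewrite /f1 /f2 /mm; ring.
  set W := a1 ^+ 2 + a2 ^+ 2 in nwx ee *; set V := b1 ^+ 2 + b2 ^+ 2.
  have W0 : 0 <= W by rewrite addr_ge0 ?sqr_ge0.
  have V0 : 0 <= V by rewrite addr_ge0 ?sqr_ge0.
  have h1 : kk * (f1 ^+ 2 + f2 ^+ 2) <= rho ^+ 2 / 2 * W.
    rewrite ff; apply: (@le_trans _ _ (kk * mm * kap * W)).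
      by rewrite mulrA -[kk * mm * kap * W]mulrA ler_wpM2l // mulr_ge0 // ltW.
    exact: ler_wpM2r.
  (* AM-GM: 2 rho kk (e . f) <= rho^2 |e|^2 + kk^2 |f|^2 *)
  have h2 : kk * (2 * rho * (e1 * f1 + e2 * f2)) <=
      kk * (rho ^+ 2 * W + kk * (f1 ^+ 2 + f2 ^+ 2)).
    have -> : kk * (rho ^+ 2 * W + kk * (f1 ^+ 2 + f2 ^+ 2)) =
      rho ^+ 2 * (kk * W) + kk * (kk * (f1 ^+ 2 + f2 ^+ 2)) by ring.
    rewrite -ee -subr_ge0.
    set A := (X in 0 <= X).
    have -> : A = (rho * e1 - kk * f1) ^+ 2 + (rho * e2 - kk * f2) ^+ 2.
      by rewrite /A; ring.
    by rewrite addr_ge0 ?sqr_ge0.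
  rewrite ler_pM2l // in h2.
  have h3 : e1 * f1 + e2 * f2 <= 3 / 4 * rho * W.
    rewrite -(@ler_pM2l _ (2 * rho)) ?mulr_gt0 //.
    apply: (le_trans h2); rewrite -subr_ge0.
    have -> : 2 * rho * (3 / 4 * rho * W) -
      (rho ^+ 2 * W + kk * (f1 ^+ 2 + f2 ^+ 2)) =
      rho ^+ 2 / 2 * W - kk * (f1 ^+ 2 + f2 ^+ 2) by field.
    by rewrite subr_ge0.
  rewrite -addrA -/V mulrDr.
  have h4 : Num.min k1 (rho / 4) * W <= rho / 4 * W.
    by rewrite ler_wpM2r // ge_min lexx orbT.
  have h5 : Num.min k1 (rho / 4) * V <= k1 * V.
    by rewrite ler_wpM2r // ge_min lexx.
  by move: h3 h4 h5; lra.
- move=> x _; rewrite /D /S /energy.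
  move: (w1 x) (w2 x) (v1 x) (v2 x) => a1 a2 b1 b2.
  have h1 := sqr_ge0 (k1 * a1 - k2 * a2 - b1).
  have h2 := sqr_ge0 (k1 * a2 + k2 * a1 - b2).
  have h3 : 0 <= kk * (b1 ^+ 2 + b2 ^+ 2).
    by rewrite mulr_ge0 ?(ltW kk0) // addr_ge0 ?sqr_ge0.
  have h4 : 0 <= kk * (a1 ^+ 2 + a2 ^+ 2).
    by rewrite mulr_ge0 ?(ltW kk0) // addr_ge0 ?sqr_ge0.
  have h5 := sqr_ge0 a1; have h6 := sqr_ge0 a2.
  have h7 := sqr_ge0 b1; have h8 := sqr_ge0 b2.
  by move: h1 h2 h3 h4 h5 h6 h7 h8; rewrite /kk; lra.
- move=> x _; rewrite /S /h /energy /w1 /w2 /v1 /v2 -subr_ge0.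
  set A := (X in 0 <= X).
  have -> : A = (p x + s x) ^+ 2 + (q x + t x) ^+ 2 + (p' x + s' x) ^+ 2 +
    (q' x + t' x) ^+ 2 by rewrite /A; ring.
  by rewrite !addr_ge0 ?sqr_ge0.
- by move=> x /T_ge0 x0; have [_ ?] := HB1 x x0; have [_ ?] := HB2 x x0; lra.
- by rewrite /D /w1 /w2 pT qT !subrr !mulr0 subr0 addr0 !mul0r addr0.
(* Values and derivatives agree at [x], so Cauchy uniqueness now applies in both directions. *)
move=> /energy_eq0[/eqP w1x /eqP w2x /eqP v1x /eqP v2x].
apply: (profile_system_uniq ode1 ode2 (a := x)).
by split; apply/eqP; rewrite -subr_eq0.
Qed.

Lemma rotation_between (p q s t : R) : p ^+ 2 + q ^+ 2 != 0 ->
  p ^+ 2 + q ^+ 2 = s ^+ 2 + t ^+ 2 ->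
  exists c d, [/\ c ^+ 2 + d ^+ 2 = 1, s = c * p - d * q & t = d * p + c * q].
Proof.
move=> n0 e; set n := p ^+ 2 + q ^+ 2 in n0 e.
(* [c + i d] is the quotient of [s + i t] by [p + i q]. *)
exists ((p * s + q * t) / n), ((p * t - q * s) / n); split.
- have -> : ((p * s + q * t) / n) ^+ 2 + ((p * t - q * s) / n) ^+ 2 =
    (p ^+ 2 + q ^+ 2) * (s ^+ 2 + t ^+ 2) / n ^+ 2 by field.
  by rewrite -/n -e -expr2 divff // expf_neq0.
- by rewrite /n; field; rewrite -/n.
- by rewrite /n; field; rewrite -/n.
Qed.

Theorem profile_system_unique_up_to_symmetry p q p' q' s t s' t' :
  profile_system p q p' q' -> profile_system s t s' t' ->
  finite_energy p q p' q' -> finite_energy s t s' t' ->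
  ~ (forall x, p x = 0 /\ q x = 0) -> ~ (forall x, s x = 0 /\ t x = 0) ->
  exists c d x0, c ^+ 2 + d ^+ 2 = 1 /\
    forall x, s x = c * p (x - x0) - d * q (x - x0) /\
              t x = d * p (x - x0) + c * q (x - x0).
Proof.
move=> ode1 ode2 fe1 fe2 nz1 nz2.
have [M M0 small] := small_amplitude_uniq.
(* Beyond [T] the amplitude stays below [M], and by intermediate values its square attains every
   level in ]0, g0], where [g0] is its value at [T]. *)
have tail u v u' v' : profile_system u v u' v' -> finite_energy u v u' v' ->
  ~ (forall x, u x = 0 /\ v x = 0) ->
  exists T g0, [/\ 0 <= T, 0 < g0,
    forall x, T <= x -> amplitude (u x) (v x) <= M &
    forall g, 0 < g -> g <= g0 -> exists2 x, T <= x & u x ^+ 2 + v x ^+ 2 = g].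
  move=> ode fe nz; have van := finite_energy_vanishes ode fe.
  have [T T0 HT] := van (M ^+ 2) (exprn_gt0 2 M0).
  have HM x : T <= x -> amplitude (u x) (v x) <= M.
    by move=> Tx; apply: amplitude_le; [exact: ltW|exact: HT].
  exists T, (u T ^+ 2 + v T ^+ 2); split => // [|g g0 gT].
    (* A profile vanishing at [T] would agree there with the zero solution, and so be zero
       everywhere. *)
    rewrite lt_def addr_ge0 ?sqr_ge0 // andbT; apply/eqP => uv0.
    move: uv0 => /eqP; rewrite paddr_eq0 ?sqr_ge0 // !sqrf_eq0.
    move=> /andP[/eqP uT /eqP vT].
    apply: nz; apply: (small _ _ _ _ _ _ _ _ T T0 ode
      (profile_system0 l1 l2 m1 m2 sigma_gt0) fe finite_energy0) => // x _.
    by rewrite amplitude_le // ?(ltW M0) // expr0n /= addr0 exprn_ge0 // ltW.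
  have [T' _ HT'] := van g g0.
  pose b := Num.max T T'.
  have Tb : T <= b by rewrite le_max lexx.
  have [||x] := @IVT R (fun x => u x ^+ 2 + v x ^+ 2) T b g Tb.
  - apply: continuous_in_subspaceT => x _; have [? ? _ _] := ode x.
    by apply: (@has_derive_continuous _ _ _ _); derive_rules.
  - rewrite le_max gT /= andbT ge_min; apply/orP; right.
    by apply: HT'; rewrite le_max lexx orbT.
  by rewrite in_itv /= => /andP[Tx _] gx; exists x.
have [T1 [g1 [T10 g10 am1 iv1]]] := tail _ _ _ _ ode1 fe1 nz1.
have [T2 [g2 [T20 g20 am2 iv2]]] := tail _ _ _ _ ode2 fe2 nz2.
(* A level attained by both tails, so that the values at [x1] and [x2] differ by a rotation only. *)
pose g := Num.min g1 g2.
have g0 : 0 < g by rewrite lt_min g10.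
have [|x1 Tx1 gx1] := iv1 g g0; first by rewrite ge_min lexx.
have [|x2 Tx2 gx2] := iv2 g g0; first by rewrite ge_min lexx orbT.
have [||c [d [cd sx tx]]] := @rotation_between (p x1) (q x1) (s x2) (t x2).
- by rewrite gx1 gt_eqF.
- by rewrite gx1 gx2.
exists c, d, (x2 - x1); split => // x.
have x10 : 0 <= x1 by exact: le_trans Tx1.
have x20 : 0 <= x2 by exact: le_trans Tx2.
(* Both points are moved to 0; as [x1] and [x2] are nonnegative, finite energy on the right
   half-line survives the shifts. *)
have := small _ _ _ _ _ _ _ _ 0 (lexx 0)
  (profile_system_shift x2 ode2)
  (profile_system_rotate cd (profile_system_shift x1 ode1))
  (finite_energy_shift x20 fe2)
  (finite_energy_rotate cd (finite_energy_shift x10 fe1)).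
rewrite /= !add0r => /(_ _ _ sx tx (x - x2)); rewrite subrK opprB addrA.
rewrite [x - x2 + x1]addrAC; apply.
- by move=> y y0; apply: am2; rewrite (le_trans Tx2) // lerDr.
- by move=> y y0; rewrite amplitude_rotate // am1 // (le_trans Tx1) // lerDr.
Qed.

End ProfileUniqueness.

(** * A smooth step function *)

Section SmoothStep.
Context {R : realType}.
Implicit Types (f g : R -> R) (x y a b : R) (n : nat) (P : {poly R}).

(** Order [n] provides [n.+1] derivatives. Quantifying over the derivative lets the closure rules go
    by induction on the order, without computing iterated derivatives. *)
Fixpoint times_derivable n f : Prop :=
  exists f' : R -> R, (forall x, has_derive f x (f' x)) /\
    (if n is n'.+1 then times_derivable n' f' else True).

Lemma times_derivableW n f : times_derivable n.+1 f -> times_derivable n f.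
Proof.
elim: n f => [|n IH] f [f' [df sf]]; exists f'; split => //.
exact: IH.
Qed.

Lemma times_derivable_cst n a : times_derivable n (fun=> a).
Proof.
elim: n a => [|n IH] a; exists (fun=> 0); split => //= x; exact: has_derive_cst.
Qed.

Lemma times_derivableD n f g : times_derivable n f -> times_derivable n g ->
  times_derivable n (fun x => f x + g x).
Proof.
elim: n f g => [|n IH] f g [f' [df sf]] [g' [dg sg]].
  by exists (fun x => f' x + g' x); split => // x; exact: has_deriveD.
exists (fun x => f' x + g' x); split; last exact: IH.
by move=> x; exact: has_deriveD.
Qed.

Lemma times_derivableM n f g : times_derivable n f -> times_derivable n g ->
  times_derivable n (fun x => f x * g x).
Proof.
elim: n f g => [|n IH] f g hf hg; have [f' [df sf]] := hf; have [g' [dg sg]] := hg.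
  by exists (fun x => f' x * g x + f x * g' x); split => // x; exact: has_deriveM.
exists (fun x => f' x * g x + f x * g' x); split.
  by move=> x; exact: has_deriveM.
by apply: times_derivableD; apply: IH => //; exact: times_derivableW.
Qed.

Lemma times_derivableN n f : times_derivable n f ->
  times_derivable n (fun x => - f x).
Proof.
move=> hf; have -> : (fun x => - f x) = (fun x => -1 * f x).
  by apply/funext => x; rewrite mulN1r.
by apply: times_derivableM => //; exact: times_derivable_cst.
Qed.

Lemma times_derivableV n f : (forall x, f x != 0) -> times_derivable n f ->
  times_derivable n (fun x => (f x)^-1).
Proof.
move=> f0; elim: n => [|n IH] hf; have [f' [df sf]] := hf.
  exists (fun x => - f' x * (f x)^-1 ^+ 2); split => // x; exact: has_deriveV.
exists (fun x => - f' x * ((f x)^-1 * (f x)^-1)); split.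
  by move=> x; rewrite -expr2; exact: has_deriveV.
have hV := IH (times_derivableW hf).
by apply: times_derivableM; [exact: times_derivableN|exact: times_derivableM].
Qed.

Lemma times_derivable_affine n f a b : times_derivable n f ->
  times_derivable n (fun x => f (a * x + b)).
Proof.
have aff x : has_derive (fun y => a * y + b) x a by derive_tac; ring.
elim: n f => [|n IH] f [f' [df sf]]; exists (fun x => f' (a * x + b) * a).
  by split => // x; apply: (@has_derive_comp _ f (fun y => a * y + b)).
split => [x|]; first by apply: (@has_derive_comp _ f (fun y => a * y + b)).
by apply: times_derivableM; [exact: IH|exact: times_derivable_cst].
Qed.

Lemma times_derivable_derive1n f : (forall n, times_derivable n f) ->
  forall n x, derivable (derive1n n f) x 1.
Proof.
move=> sf n; elim: n f {sf}(sf n) => [|n IH] f [f' [df sf]] x.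
  exact: has_derive_derivable (df x).
rewrite /derive1n iterSr (_ : derive1 f = f'); first exact: IH.
by apply/funext => y; exact: has_derive_derive1.
Qed.

Lemma has_derive0_quadratic f x c : (forall y, `|f y - f x| <= c * (y - x) ^+ 2) ->
  has_derive f x 0.
Proof.
move=> fq; apply/is_derive1_caratheodory.
exists (fun y => (f y - f x) / (y - x)); split => [y||].
- have [->|yx] := eqVneq y x; first by rewrite !subrr mulr0.
  by rewrite divfK // subr_eq0.
- have c0 : 0 <= c.
    have := le_trans (normr_ge0 _) (fq (x + 1)).
    by rewrite addrAC subrr add0r expr1n mulr1.
  apply/cvgrPdist_le => /= e e0; apply/nbhs_ballP.
  exists (e / (c + 1)) => [|y]; first by rewrite /= divr_gt0 // ltr_wpDl.
  rewrite !subrr mul0r sub0r normrN.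
  have [->|yx] := eqVneq y x; first by rewrite !subrr mul0r normr0 ltW.
  rewrite /ball /= distrC ltr_pdivlMr ?ltr_wpDl // => /ltW xye.
  rewrite normrM normfV ler_pdivrMr ?normr_gt0 ?subr_eq0 //.
  apply: (le_trans (fq y)); rewrite -[(y - x) ^+ 2]ger0_norm ?sqr_ge0 //.
  rewrite normrX expr2 mulrA ler_wpM2r // (le_trans _ xye) //.
  by rewrite mulrDr mulr1 mulrC lerDl.
- by rewrite subrr mul0r.
Qed.

Lemma horner_le_expR P : exists2 c : R, 0 <= c &
  forall u, 0 <= u -> `|P.[u]| <= c * expR u.
Proof.
(* Each monomial satisfies [u^i <= i! exp(u)]. *)
exists (\sum_(i < size P) `|P`_i| * i`!%:R) => [|u u0].
  by apply: sumr_ge0 => i _; rewrite mulr_ge0.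
rewrite horner_coef (le_trans (ler_norm_sum _ _ _)) // mulr_suml.
apply: ler_sum => i _; rewrite normrM -mulrA ler_wpM2l // normrX ger0_norm //.
case: (i : nat) => [|n].
  by rewrite expr0 fact0 mul1r (le_trans _ (expR_ge1Dx u)) // lerDl.
have := expR_ge1Dxn n u0; rewrite -ler_pdivrMl ?ltr0n ?fact_gt0 //.
by move=> h; rewrite mulrC (le_trans _ h) // lerDr.
Qed.

(** The polynomial factor makes the family of [exp(-1/x)] stable under derivation. *)
Definition flat P x : R := if 0 < x then P.[x^-1] * expR (- x^-1) else 0.

(** With [u = 1/x] and [u' = - u^2], the product [P(u) exp(- u)] has derivative
    [u^2 (P - P')(u) exp(- u)]. At 0, the bound [u^2 |P(u)| <= c exp(u)] makes the function at most
    [c x^2]. *)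
Lemma has_derive_flat P x : has_derive (flat P) x (flat ('X^2 * (P - P^`())) x).
Proof.
have [x0|x0|->] := ltgtP x 0.
- apply: (@near_eq_is_derive _ _ _ (fun=> 0)); last first.
    by rewrite /flat ltNge (ltW x0) /=; exact: has_derive_cst.
  apply: filterS (lt_nbhsl x0) => y y0.
  by rewrite /flat ltNge (ltW y0).
- apply: (@near_eq_is_derive _ _ _ (fun y => P.[y^-1] * expR (- y^-1))).
    by apply: filterS (lt_nbhsr x0) => y y0; rewrite /flat y0.
  rewrite /flat x0.
  have dV : has_derive (fun y => y^-1) x (- 1 * x^-1 ^+ 2).
    by apply: (@has_deriveV _ (fun y => y)); [rewrite gt_eqF|exact: has_derive_id].
  have dP : has_derive (fun y => P.[y^-1]) x (P^`().[x^-1] * (- 1 * x^-1 ^+ 2)).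
    apply: (@has_derive_comp _ (horner P) (fun y => y^-1)) => //.
    exact: is_derive_poly.
  derive_tac; rewrite hornerM hornerXn hornerD hornerN; ring.
- have [c c0 hc] := horner_le_expR ('X^2 * P).
  rewrite {2}/flat ltxx; apply: (@has_derive0_quadratic _ _ c) => y.
  rewrite /flat ltxx !subr0; case: ifPn => [y0|_]; last first.
    by rewrite normr0 mulr_ge0 // sqr_ge0.
  have := hc y^-1; rewrite invr_ge0 (ltW y0) => /(_ isT).
  rewrite hornerM hornerXn normrM normrX ger0_norm ?invr_ge0 ?(ltW y0) // => h.
  rewrite normrM (ger0_norm (expR_ge0 _)).
  have -> : `|P.[y^-1]| = y ^+ 2 * (y^-1 ^+ 2 * `|P.[y^-1]|).
    by field; rewrite gt_eqF.
  have -> : c * y ^+ 2 = y ^+ 2 * (c * expR y^-1) * expR (- y^-1).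
    by rewrite -[RHS]mulrA -[in RHS](mulrA c) expRxMexpNx_1 mulr1 mulrC.
  by rewrite ler_wpM2r ?expR_ge0 // ler_wpM2l ?sqr_ge0.
Qed.

Lemma times_derivable_flat n P : times_derivable n (flat P).
Proof.
elim: n P => [|n IH] P; exists (flat ('X^2 * (P - P^`()))).
  by split => // x; exact: has_derive_flat.
by split => // x; exact: has_derive_flat.
Qed.

Definition smooth_step x : R := flat 1 x / (flat 1 x + flat 1 (1 - x)).

Lemma flat1_ge0 x : 0 <= flat 1 x.
Proof. by rewrite /flat; case: ifP => // _; rewrite hornerC mul1r expR_ge0. Qed.

Lemma flat1_gt0 x : 0 < x -> 0 < flat 1 x.
Proof. by move=> x0; rewrite /flat x0 hornerC mul1r expR_gt0. Qed.

Lemma flat1_eq0 x : x <= 0 -> flat 1 x = 0.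
Proof. by rewrite /flat leNgt => /negbTE ->. Qed.

Lemma smooth_step_den x : 0 < flat 1 x + flat 1 (1 - x).
Proof.
have [x0|x0] := ltP 0 x; first by rewrite ltr_pwDl ?flat1_gt0 ?flat1_ge0.
by rewrite ltr_wpDl ?flat1_ge0 // flat1_gt0 // subr_gt0 (le_lt_trans x0).
Qed.

Lemma times_derivable_smooth_step n : times_derivable n smooth_step.
Proof.
apply: times_derivableM; first exact: times_derivable_flat.
apply: times_derivableV => [x|]; first by rewrite gt_eqF // smooth_step_den.
apply: times_derivableD; first exact: times_derivable_flat.
have -> : (fun x => flat 1 (1 - x)) = (fun x => flat 1 (-1 * x + 1)).
  by apply/funext => x; rewrite mulN1r addrC.
by apply: times_derivable_affine; exact: times_derivable_flat.
Qed.

Lemma smooth_step_itv x : 0 <= smooth_step x <= 1.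
Proof.
rewrite divr_ge0 ?flat1_ge0 ?(ltW (smooth_step_den _)) //=.
by rewrite ler_pdivrMr ?smooth_step_den // mul1r lerDl flat1_ge0.
Qed.

Lemma smooth_step0 x : x <= 0 -> smooth_step x = 0.
Proof. by move=> x0; rewrite /smooth_step flat1_eq0 // mul0r. Qed.

Lemma smooth_step1 x : 1 <= x -> smooth_step x = 1.
Proof.
move=> x1; rewrite /smooth_step [flat 1 (1 - x)]flat1_eq0 ?subr_le0 // addr0 divff //.
by rewrite gt_eqF // flat1_gt0 // (lt_le_trans _ x1).
Qed.

End SmoothStep.

(** * Weak derivatives *)

Section LocallyIntegrable.
Context {R : realType}.
Local Notation mu := (@lebesgue_measure R).
Implicit Types (f g h : R -> R) (a b c x y : R).

Lemma continuous_locally_integrable f : continuous f ->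
  locally_integrable [set: R] f.
Proof.
move=> cf; split => //; first exact: continuous_measurable_fun.
  exact: openT.
move=> K _ cK.
have /integrableP[_] : mu.-integrable K (EFin \o f).
  by apply: continuous_compact_integrable => //; exact: continuous_subspaceT.
by [].
Qed.

Lemma locally_integrable_segment f a b : locally_integrable [set: R] f ->
  mu.-integrable `[a, b] (EFin \o f).
Proof.
move=> [mf _ /(_ `[a, b]%classic (@subsetT _ _) (@segment_compact _ a b)) intf].
apply/integrableP; split => //.
by apply/measurable_EFinP; exact: measurable_funTS.
Qed.

Lemma locally_integrable_mul_continuous_segment f h a b :
  locally_integrable [set: R] f -> continuous h ->
  mu.-integrable `[a, b] (EFin \o (fun x => f x * h x)).
Proof.
move=> lf ch; have := @integrableMl _ _ _ mu `[a, b]%classic (measurable_itv _)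
  (EFin \o f) h (locally_integrable_segment a b lf) .
move=> H; have -> : EFin \o (fun x => f x * h x) = ((EFin \o f) \* (EFin \o h))%E.
  by apply/funext => x; rewrite /= EFinM.
apply: H.
  by apply: measurable_funTS; exact: continuous_measurable_fun.
have := continuous_compact (continuous_subspaceT ch) (@segment_compact _ a b).
move=> /compact_bounded[M [Mr HM]]; exists M; split => // N MN x /= xab.
by apply: (HM N MN); exists x.
Qed.

Lemma Rintegral_support f a b : (forall x, ~~ (a <= x <= b) -> f x = 0) ->
  (\int[mu]_x f x = \int[mu]_(x in `[a, b]) f x)%R.
Proof.
move=> f0; rewrite [RHS]Rintegral_mkcond; apply: eq_Rintegral => x _.
rewrite patchE; case: ifPn => //; rewrite notin_setE /= in_itv /= => /negP.
exact: f0.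
Qed.

End LocallyIntegrable.

(** * Mollification at Lebesgue points *)

Section SmoothStepKernel.
Context {R : realType}.
Local Notation mu := (@lebesgue_measure R).
Implicit Types (f g h : R -> R) (a b c x y e : R).
Local Notation dS := (derive1 (@smooth_step R)).

Lemma has_derive_smooth_step x : has_derive smooth_step x (dS x).
Proof.
have [f' [df _]] := @times_derivable_smooth_step R 0.
exact/derivable_has_derive/(has_derive_derivable (df x)).
Qed.

Lemma continuous_derive1_smooth_step : continuous dS.
Proof.
have [f' [df [f'' [ddf _]]]] := @times_derivable_smooth_step R 1.
have -> : dS = f' by apply/funext => y; exact: has_derive_derive1.
by move=> x; exact: has_derive_continuous (ddf x).
Qed.

Lemma derive1_smooth_step_out x : ~~ (0 <= x <= 1) -> dS x = 0.
Proof.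
rewrite negb_and -!ltNge => /orP[x0|x1]; apply: has_derive_derive1.
- apply: (near_eq_is_derive _ (has_derive_cst x 0)).
  by apply: filterS (lt_nbhsl x0) => y /ltW y0; rewrite smooth_step0.
- apply: (near_eq_is_derive _ (has_derive_cst x 1)).
  by apply: filterS (lt_nbhsr x1) => y /ltW y0; rewrite smooth_step1.
Qed.

Lemma derive1_smooth_step_bounded : exists2 C : R, 0 < C & forall x, `|dS x| <= C.
Proof.
have [|c c01 hc] := @EVT_max R (fun x => `|dS x|) 0 1 ler01.
  apply: continuous_subspaceT => x; apply: continuous_comp.
    exact: continuous_derive1_smooth_step.
  exact: norm_continuous.
exists (`|dS c| + 1) => [|x]; first by rewrite ltr_wpDl.
have [x01|/derive1_smooth_step_out ->] := boolP (0 <= x <= 1).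
  by rewrite ler_wpDr // hc // in_itv.
by rewrite normr0 addr_ge0.
Qed.

(** The derivative of this step is an approximate identity carried by [a, a + e]. The argument is
    written as an affine function to fit [times_derivable_affine]. *)
Definition step_at a e x : R := smooth_step (e^-1 * x - e^-1 * a).

Lemma has_derive_step_at a e x :
  has_derive (step_at a e) x (e^-1 * dS (e^-1 * x - e^-1 * a)).
Proof.
have := has_derive_smooth_step (e^-1 * x - e^-1 * a) => dSx.
apply: has_derive_eq.
  apply: (@has_derive_comp _ _ (fun x => e^-1 * x - e^-1 * a)) dSx _; derive_rules.
cbv beta; ring.
Qed.

Lemma step_at_arg a e x : e^-1 * x - e^-1 * a = (x - a) / e.
Proof. by rewrite -mulrBr mulrC. Qed.

Lemma continuous_derive1_step_at a e : continuous (derive1 (step_at a e)).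
Proof.
have -> : derive1 (step_at a e) = fun x => e^-1 * dS (e^-1 * x - e^-1 * a).
  by apply/funext => x; apply: has_derive_derive1; exact: has_derive_step_at.
move=> x; apply: cvgM; first exact: cvg_cst.
apply: (@continuous_comp _ _ _ (fun x => e^-1 * x - e^-1 * a) dS); last first.
  exact: continuous_derive1_smooth_step.
by apply: (@has_derive_continuous _ _ _ _); derive_rules.
Qed.

Lemma derive1_step_at_out a e x : 0 < e -> ~~ (a <= x <= a + e) ->
  derive1 (step_at a e) x = 0.
Proof.
move=> e0 h; rewrite (has_derive_derive1 (has_derive_step_at _ _ _)) step_at_arg.
rewrite derive1_smooth_step_out ?mulr0 // ler_pdivlMr // mul0r subr_ge0.
by rewrite ler_pdivrMr // mul1r lerBlDl.
Qed.

Lemma Rintegral_derive1_step_at a e : 0 < e ->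
  (\int[mu]_(x in `[a, (a + e)]) derive1 (step_at a e) x = 1)%R.
Proof.
move=> e0; have ae : a < a + e by rewrite ltrDl.
have cS : continuous (step_at a e).
  by move=> x; exact: has_derive_continuous (has_derive_step_at a e x).
rewrite /Rintegral (@continuous_FTC2 R (derive1 (step_at a e)) (step_at a e)) //.
- have -> : step_at a e a = 0 by rewrite /step_at subrr smooth_step0.
  have -> : step_at a e (a + e) = 1.
    rewrite /step_at step_at_arg (_ : a + e - a = e); last by ring.
    by rewrite divff ?gt_eqF // smooth_step1.
  by rewrite -EFinB subr0.
- by apply: continuous_subspaceT; exact: continuous_derive1_step_at.
- split.
  + by move=> x _; exact: has_derive_derivable (has_derive_step_at a e x).
  + exact/cvg_at_right_filter/cS.
  + exact/cvg_at_left_filter/cS.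
Qed.

(** The kernel has mass 1 and is at most [C / e] on an interval of length [e], so the error is
    controlled by the mean of [|f - f a|] near [a], which tends to 0 at a Lebesgue point. *)
Lemma step_kernel_bound : exists2 C : R, 0 < C & forall f a e,
  locally_integrable [set: R] f -> 0 < e ->
  `| \int[mu]_x (f x * derive1 (step_at a e) x) - f a |
    <= C * fine (davg f a (2 * e)).
Proof.
have [C C0 HC] := derive1_smooth_step_bounded.
(* The ball of radius [2 * e] has length [4 * e]; this radius keeps the closed interval [a, a + e]
   inside an open ball. *)
exists (4 * C) => [|f a e lf e0]; first by rewrite mulr_gt0.
set k := derive1 (step_at a e).
have ck : continuous k by exact: continuous_derive1_step_at.
have lfa : locally_integrable [set: R] (f \- cst (f a)).
  apply: locally_integrableB => //; apply: continuous_locally_integrable.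
  exact: cst_continuous.
have kC x : `|k x| <= C / e.
  rewrite /k (has_derive_derive1 (has_derive_step_at _ _ _)) normrM mulrC.
  by rewrite (@ger0_norm _ e^-1) ?invr_ge0 ?(ltW e0) // ler_wpM2r // invr_ge0 ltW.
rewrite (@Rintegral_support _ _ a (a + e)); last first.
  by move=> x h; rewrite /k derive1_step_at_out // mulr0.
have ifk := locally_integrable_mul_continuous_segment a (a + e) lf ck.
have ik : mu.-integrable `[a, (a + e)] (EFin \o k).
  exact: locally_integrable_segment (continuous_locally_integrable ck).
have -> : (\int[mu]_(x in `[a, (a + e)]) (f x * k x) - f a =
    \int[mu]_(x in `[a, (a + e)]) ((f x - f a) * k x))%R.
  under [RHS]eq_Rintegral do rewrite mulrBl.
  rewrite RintegralB //; last first.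
    have -> : EFin \o (fun x => f a * k x) = (fun x => (f a)%:E * (EFin \o k) x)%E.
      by apply/funext => x; rewrite /= EFinM.
    exact: integrableZl.
  by rewrite RintegralZl // Rintegral_derive1_step_at // mulr1.
have ifak : mu.-integrable `[a, (a + e)] (EFin \o (fun x => (f x - f a) * k x)).
  exact: locally_integrable_mul_continuous_segment lfa ck.
apply: (le_trans (le_normr_Rintegral _ ifak)) => //.
have ifa := locally_integrable_segment a (a + e) lfa.
have inorm : mu.-integrable `[a, (a + e)] (EFin \o (fun x => `|f x - f a|)).
  exact: integrable_norm ifa.
apply: (@le_trans _ _ (\int[mu]_(x in `[a, (a + e)]) ((C / e) * `|f x - f a|))%R).
  apply: le_Rintegral => //.
  - exact: integrable_norm ifak.
  - have -> : EFin \o (fun x => C / e * `|f x - f a|) =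
      (fun x => (C / e)%:E * (EFin \o (fun x => `|f x - f a|)%R) x)%E.
      by apply/funext => x; rewrite /= EFinM.
    exact: integrableZl.
  - by move=> x _; rewrite normrM mulrC ler_wpM2r.
rewrite RintegralZl //.
have B2 : `[a, (a + e)]%classic `<=` ball a (2 * e).
  move=> x; rewrite /= in_itv /= => /andP[ax xae]; rewrite /ball /= ltr_norml.
  by apply/andP; split; lra.
have e20 : 0 < 2 * e by rewrite mulr_gt0.
have iball : mu.-integrable (ball a (2 * e)) (EFin \o (fun x => `|f x - f a|)).
  have i2 : mu.-integrable `[a - 2 * e, a + 2 * e] (EFin \o (fun x => `|f x - f a|)).
    exact: integrable_norm (locally_integrable_segment _ _ lfa).
  apply: integrableS i2 => //; first exact: measurable_ball.
  move=> x; rewrite /ball /= in_itv /= ltr_norml => /andP[h1 h2].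
  by apply/andP; split; lra.
have -> : fine (davg f a (2 * e)) =
   (4 * e)^-1 * (\int[mu]_(x in ball a (2 * e)) `|f x - f a|)%R.
  rewrite /davg /iavg lebesgue_measure_ball ?(ltW e20) // inver.
  have -> : (2 * e) *+ 2 = 4 * e by ring.
  rewrite gt_eqF ?mulr_gt0 // fineM //.
  by apply: (integrable_fin_num _ iball); exact: measurable_ball.
have -> : 4 * C * ((4 * e)^-1 * (\int[mu]_(x in ball a (2 * e)) `|f x - f a|)%R) =
  C / e * (\int[mu]_(x in ball a (2 * e)) `|f x - f a|)%R.
  by field; rewrite gt_eqF.
rewrite ler_wpM2l ?divr_ge0 ?(ltW C0) ?(ltW e0) //.
apply: fine_le; [exact: integrable_fin_num| |].
  by apply: (integrable_fin_num _ iball); exact: measurable_ball.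
apply: ge0_subset_integral => //.
- by rewrite ball_itv; exact: measurable_itv.
- by case/integrableP: iball.
Qed.

End SmoothStepKernel.

(** * Increments as integrals of the weak derivative *)

Section WeakDerivative.
Context {R : realType}.
Local Notation mu := (@lebesgue_measure R).
Implicit Types (f g h : R -> R) (a b c x y e : R).

Lemma step_kernel_cvg f a : locally_integrable [set: R] f -> lebesgue_pt f a ->
  (\int[mu]_x (f x * derive1 (step_at a (harmonic n)) x))%R @[n --> \oo] --> f a.
Proof.
move=> lf fa; have [C C0 HC] := @step_kernel_bound R.
have /fine_cvg fa0 : davg f a r @[r --> (0:R)^'+] --> (0:R)%:E by [].
have cb : C * fine (davg f a (2 * harmonic n)) @[n --> \oo] --> 0.
  rewrite -(mulr0 C); apply: cvgMr.
  have /cvg_at_rightP := fa0; apply; split=> [n|].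
    by rewrite mulr_gt0 // /harmonic invr_gt0.
  by rewrite -(mulr0 2); apply: cvgMr; exact: cvg_harmonic.
apply/cvgrPdist_le => e e0; move/cvgrPdist_le : cb => /(_ e e0).
apply: filterS => n; rewrite sub0r normrN => h; rewrite distrC.
apply: le_trans (HC f a (harmonic n) lf _) _; first by rewrite invr_gt0.
exact: le_trans (ler_norm _) h.
Qed.

Definition cutoff a b e x : R := step_at a e x - step_at b e x.

Lemma has_derive_cutoff a b e x : has_derive (cutoff a b e) x
  (derive1 (step_at a e) x - derive1 (step_at b e) x).
Proof.
by apply: has_deriveB; apply/derivable_has_derive/has_derive_derivable;
  exact: has_derive_step_at.
Qed.

Lemma step_at_lt a e x : 0 < e -> x <= a -> step_at a e x = 0.
Proof.
move=> e0 xa; rewrite /step_at step_at_arg smooth_step0 //.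
by rewrite pmulr_lle0 ?invr_gt0 // subr_le0.
Qed.

Lemma step_at_gt a e x : 0 < e -> a + e <= x -> step_at a e x = 1.
Proof.
move=> e0 xa; rewrite /step_at step_at_arg smooth_step1 //.
by rewrite ler_pdivlMr // mul1r lerBrDl.
Qed.

Lemma cutoff_out a b e x : a < b -> 0 < e -> ~~ (a <= x <= b + e) ->
  cutoff a b e x = 0.
Proof.
move=> ab e0; rewrite negb_and -!ltNge => /orP[xa|bx]; rewrite /cutoff.
  by rewrite !step_at_lt ?subrr // ltW // (lt_trans xa).
by rewrite !step_at_gt ?subrr // ltW // (le_lt_trans _ bx) // lerD2r ltW.
Qed.

Lemma cutoff_le1 a b e x : `|cutoff a b e x| <= 1.
Proof.
rewrite /cutoff /step_at.
have := smooth_step_itv (e^-1 * x - e^-1 * a).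
have := smooth_step_itv (e^-1 * x - e^-1 * b).
move: (smooth_step _) (smooth_step _) => s t /andP[s0 s1] /andP[t0 t1].
by rewrite ler_norml; apply/andP; split; lra.
Qed.

Lemma test_function_cutoff a b e : a < b -> 0 < e -> test_function (cutoff a b e).
Proof.
move=> ab e0; split.
  apply: times_derivable_derive1n => n.
  have step c : times_derivable n (step_at c e).
    exact: times_derivable_affine (times_derivable_smooth_step n).
  by apply: times_derivableD => //; exact: times_derivableN.
exists (`|a| + `|b| + e) => x; rewrite lter_normr => xab; apply: cutoff_out => //.
rewrite negb_and -!ltNge; apply/orP.
have h1 := ler_norm b; have h2 := ler_norm (- a).
have h3 := ler_norm a; have h4 := ler_norm (- b); rewrite !normrN in h2 h4.
by move: xab => /orP[] h; [right|left]; lra.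
Qed.

(** Each step rises to the right of its base point, so the limit excludes [a] and includes [b]. *)
Lemma cutoff_cvg a b x : a < b ->
  cutoff a b (harmonic n) x @[n --> \oo] --> (\1_(`]a, b]) x : R).
Proof.
move=> ab; apply: cvg_near_cst.
have small c : c < x -> \forall n \near \oo, c + harmonic n <= x :> R.
  move=> cx; have := @cvg_harmonic R => /cvgrPdist_le /(_ (x - c)).
  rewrite subr_gt0 => /(_ cx); apply: filterS => n.
  by rewrite sub0r normrN ger0_norm ?harmonic_ge0 // lerBrDl.
have h0 n : 0 < harmonic n :> R by rewrite invr_gt0.
rewrite indicE; have [xa|ax] := leP x a.
  apply: nearW => n; rewrite memNset; last by rewrite /= in_itv /= ltNge xa.
  by rewrite /cutoff !step_at_lt ?subrr // (le_trans xa) // ltW.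
have [xb|bx] := leP x b.
  apply: filterS (small a ax) => n h.
  rewrite mem_set; last by rewrite /= in_itv /= ax.
  by rewrite /cutoff step_at_gt // step_at_lt // subr0.
apply: filterS2 (small a ax) (small b bx) => n h1 h2.
rewrite memNset; last by rewrite /= in_itv /= ax leNgt bx.
by rewrite /cutoff !step_at_gt // subrr.
Qed.

(** Dominated convergence with bound [|g|] on the fixed interval [a, b + 1], which contains all the
    supports because [harmonic n <= 1]. *)
Lemma Rintegral_cutoff_cvg g a b : locally_integrable [set: R] g -> a < b ->
  (\int[mu]_x (g x * cutoff a b (harmonic n) x))%R @[n --> \oo] -->
  (\int[mu]_(x in `[a, b]) g x)%R.
Proof.
move=> lg ab.
have h0 n : 0 < harmonic n :> R by rewrite invr_gt0.
have h1 n : harmonic n <= 1 :> R by rewrite invf_le1 // ler1n.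
have ccut n : continuous (cutoff a b (harmonic n)).
  by move=> x; exact: has_derive_continuous (has_derive_cutoff _ _ _ _).
pose fn n x := g x * cutoff a b (harmonic n) x.
have ifn n : mu.-integrable `[a, (b + 1)] (EFin \o fn n).
  exact: locally_integrable_mul_continuous_segment.
pose G : R -> R := g \_ `]a, b].
have mg : measurable_fun [set: R] g by case: lg.
have ig := locally_integrable_segment a (b + 1) lg.
have [|||||iG _ cG] := @dominated_convergence _ _ _ mu `[a, (b + 1)]%classic
    (measurable_itv _) (fun n => EFin \o fn n) (EFin \o G) (EFin \o (fun x => `|g x|)).
- by move=> n; exact: (measurable_int mu).
- apply/measurable_EFinP; apply: measurable_funTS.
  by apply/(measurable_restrictT _ _).1 => //; exact: measurable_funTS.
- apply: aeW => x _; apply: cvg_EFin; first exact: nearW.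
  have -> : G x = g x * \1_(`]a, b]) x.
    by rewrite /G patchE indicE; case: ifP => _; rewrite ?mulr1 ?mulr0.
  by apply: cvgMr; exact: cutoff_cvg.
- exact: integrable_norm ig.
- apply: aeW => x n _ /=; rewrite lee_fin /fn normrM.
  by rewrite -[leRHS]mulr1 ler_wpM2l // cutoff_le1.
have -> : (fun n => \int[mu]_x (g x * cutoff a b (harmonic n) x))%R =
    (fun n => \int[mu]_(x in `[a, (b + 1)%R]) fn n x)%R.
  apply/funext => n; apply: Rintegral_support => x xab.
  rewrite cutoff_out ?mulr0 //; apply: contra xab => /andP[-> xb] /=.
  by rewrite (le_trans xb) // lerD2l.
have -> : (\int[mu]_(x in `[a, b]) g x)%R = (\int[mu]_(x in `[a, (b + 1)%R]) G x)%R.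
  rewrite -Rintegral_mkcondr -Rintegral_itv_obnd_cbnd; last first.
    apply: integrableS (locally_integrable_segment a b lg) => //.
    exact: subset_itv_oc_cc.
  congr (Rintegral _ _ _); apply/seteqP; split => x /=; rewrite !in_itv /=.
    move=> /andP[ax xb]; rewrite ax xb (ltW ax) (le_trans xb) //.
    by rewrite lerDl.
  by move=> [].
apply: fine_cvg; rewrite fineK; last exact: integrable_fin_num.
exact: cG.
Qed.

Lemma weak_derivative_lebesgue_pt f g a b : weak_derivative f g -> a < b ->
  lebesgue_pt f a -> lebesgue_pt f b ->
  f b - f a = (\int[mu]_(x in `[a, b]) g x)%R.
Proof.
move=> [lf lg fg] ab fa fb.
have h0 n : 0 < harmonic n :> R by rewrite invr_gt0.
have ca := step_kernel_cvg lf fa; have cb := step_kernel_cvg lf fb.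
have cg := Rintegral_cutoff_cvg lg ab.
have cfab : (\int[mu]_x (f x * derive1 (step_at a (harmonic n)) x) -
    \int[mu]_x (f x * derive1 (step_at b (harmonic n)) x))%R @[n --> \oo] -->
    f a - f b by exact: cvgB.
have e : (fun n => \int[mu]_x (f x * derive1 (step_at a (harmonic n)) x) -
     \int[mu]_x (f x * derive1 (step_at b (harmonic n)) x))%R =
   (fun n => - \int[mu]_x (g x * cutoff a b (harmonic n) x))%R.
  apply/funext => n; rewrite -(fg _ (test_function_cutoff ab (h0 n))).
  have supp c : a <= c <= b -> forall x, ~~ (a <= x <= b + harmonic n) ->
     f x * derive1 (step_at c (harmonic n)) x = 0.
    move=> /andP[ac cb'] x xab; rewrite derive1_step_at_out ?mulr0 //.
    apply: contra xab => /andP[cx xc]; rewrite (le_trans ac) //=.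
    by rewrite (le_trans xc) // lerD2r.
  have supp' x : ~~ (a <= x <= b + harmonic n) ->
      f x * derive1 (cutoff a b (harmonic n)) x = 0.
    move=> xab; rewrite (has_derive_derive1 (has_derive_cutoff _ _ _ _)).
    by rewrite mulrBr !supp ?subrr // lexx ltW.
  rewrite (Rintegral_support (supp a _)) ?lexx ?(ltW ab) //.
  rewrite (Rintegral_support (supp b _)) ?lexx ?(ltW ab) //.
  rewrite (Rintegral_support supp') -RintegralB //; first last.
  - apply: locally_integrable_mul_continuous_segment => //.
    exact: continuous_derive1_step_at.
  - apply: locally_integrable_mul_continuous_segment => //.
    exact: continuous_derive1_step_at.
  apply: eq_Rintegral => x _.
  by rewrite (has_derive_derive1 (has_derive_cutoff _ _ _ _)) mulrBr.
have : f a - f b = - (\int[mu]_(x in `[a, b]) g x)%R.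
  rewrite e in cfab; have /cvg_lim <- := cfab; last exact: Rhausdorff.
  by apply: cvg_lim; [exact: Rhausdorff|exact: cvgN].
by move=> h; rewrite -opprB h opprK.
Qed.

End WeakDerivative.

(** * Primitives and continuous representatives *)

Section Primitive.
Context {R : realType}.
Local Notation mu := (@lebesgue_measure R).
Implicit Types (f g h : R -> R) (a b c x y : R).

Lemma Rintegral_segment_ge f a b : b <= a -> (\int[mu]_(x in `[a, b]) f x)%R = 0.
Proof.
rewrite le_eqVlt => /orP[/eqP ->|ba]; first by rewrite set_itv1 Rintegral_set1.
by rewrite set_itv_ge ?Rintegral_set0 // bnd_simp -ltNge.
Qed.

Lemma Rintegral_segmentD f a b c : locally_integrable [set: R] f ->
  a <= b -> b <= c ->
  (\int[mu]_(x in `[a, c]) f x = \int[mu]_(x in `[a, b]) f x +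
     \int[mu]_(x in `[b, c]) f x)%R.
Proof.
move=> lf ab bc; apply/eqP; rewrite addrC -subr_eq; apply/eqP.
rewrite Rintegral_itvB ?bnd_simp //; last exact: locally_integrable_segment.
rewrite Rintegral_itv_obnd_cbnd //.
apply: integrableS (locally_integrable_segment b c lf) => //.
exact: subset_itv_oc_cc.
Qed.

Lemma ae_imply (P Q : R -> Prop) : (forall x, P x -> Q x) ->
  {ae mu, forall x, P x} -> {ae mu, forall x, Q x}.
Proof. by move=> PQ; exact: (@filterS _ _ (ae_filter_ringOfSetsType mu) P Q). Qed.

Lemma ae_imply2 (P Q S : R -> Prop) : (forall x, P x -> Q x -> S x) ->
  {ae mu, forall x, P x} -> {ae mu, forall x, Q x} -> {ae mu, forall x, S x}.
Proof.
by move=> PQS; exact: (@filterS2 _ _ (ae_filter_ringOfSetsType mu) P Q S).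
Qed.

(* One of the two segments is empty unless [x = 0]. *)
Definition primitive f x : R :=
  (\int[mu]_(t in `[0%R, x]) f t - \int[mu]_(t in `[x, 0%R]) f t)%R.

Lemma primitiveB f a b : locally_integrable [set: R] f -> a <= b ->
  primitive f b - primitive f a = (\int[mu]_(t in `[a, b]) f t)%R.
Proof.
move=> lf ab; rewrite /primitive.
have [a0|/ltW a0] := leP 0 a.
  rewrite [X in _ - X - _]Rintegral_segment_ge ?(le_trans a0) //.
  rewrite [X in _ - (_ - X)]Rintegral_segment_ge // !subr0.
  by rewrite (Rintegral_segmentD lf a0 ab) addrAC subrr add0r.
rewrite [X in _ - (X - _)]Rintegral_segment_ge // sub0r opprK.
have [b0|/ltW b0] := leP 0 b.
  rewrite [X in _ - X + _]Rintegral_segment_ge // subr0.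
  by rewrite (Rintegral_segmentD lf a0 b0) addrC.
rewrite [X in X - _ + _]Rintegral_segment_ge // sub0r.
by rewrite (Rintegral_segmentD lf ab b0) addrC addrK.
Qed.

(** The fundamental theorem concerns integrals with a fixed left end; this recentres [primitive] at
    [x - 1], whatever the sign of [x]. *)
Lemma primitive_near f x : locally_integrable [set: R] f ->
  \forall y \near x, primitive f (x - 1) + (\int[mu]_(t in `[x - 1, y]) f t)%R =
    primitive f y.
Proof.
move=> lf; have x1 : x - 1 < x by rewrite gtrBl.
apply: filterS (lt_nbhsr x1) => y /ltW xy.
by rewrite -(primitiveB lf xy) addrC subrK.
Qed.

Lemma continuous_primitive f : locally_integrable [set: R] f ->
  continuous (primitive f).
Proof.
move=> lf x; have := primitive_near x lf => near_x.
have x11 : x - 1 < x + 1 by rewrite ltrBlDr -addrA ltrDl addr_gt0.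
have := @parameterized_integral_continuous R (x - 1) (x + 1) f (ltW x11)
  (locally_integrable_segment _ _ lf).
move=> /(continuous_within_itvP _ x11)[/(_ x) + _ _].
rewrite in_itv /= gtrBl ltrDl ltr01 => /(_ isT) cx.
rewrite /continuous_at -(nbhs_singleton near_x).
apply: cvg_trans; first exact: (near_eq_cvg near_x).
by apply: cvgD; [exact: cvg_cst|exact: cx].
Qed.

Lemma has_derive_primitive_lebesgue_pt f x : locally_integrable [set: R] f ->
  lebesgue_pt f x -> has_derive (primitive f) x (f x).
Proof.
move=> lf fx; have xx1 : x < x + 1 by rewrite ltrDl.
apply: (near_eq_is_derive (primitive_near x lf)).
rewrite -[f x]add0r; apply: has_deriveD; first exact: has_derive_cst.
have [|d1 d2] := @FTC1_lebesgue_pt R f (BLeft (x - 1)) x (x + 1) xx1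
  (locally_integrable_segment _ _ lf) _ fx.
  by rewrite (@lte_fin R) gtrBl.
by rewrite -d2; exact: derivable_has_derive.
Qed.

Lemma has_derive_primitive f x : continuous f -> has_derive (primitive f) x (f x).
Proof.
move=> cf; apply: has_derive_primitive_lebesgue_pt.
  exact: continuous_locally_integrable.
apply: (@continuous_lebesgue_pt _ _ _ [set: R]) => //.
- by split; [exact: openT|].
- exact: continuous_measurable_fun.
- exact: cf.
Qed.

Lemma eq_primitive_ae f g : locally_integrable [set: R] f ->
  locally_integrable [set: R] g -> {ae mu, forall x, f x = g x} ->
  primitive f = primitive g.
Proof.
move=> lf lg fg.
have eq_int a b : (\int[mu]_(t in `[a, b]) f t = \int[mu]_(t in `[a, b]) g t)%R.
  congr fine; apply: ae_eq_integral => //.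
  - exact: (measurable_int mu (locally_integrable_segment a b lf)).
  - exact: (measurable_int mu (locally_integrable_segment a b lg)).
  - by apply: (ae_imply _ fg) => x ->.
by apply/funext => x; rewrite /primitive !eq_int.
Qed.

Lemma null_set_ball (N : set R) x (e : R) : measurable N -> mu N = 0 -> 0 < e ->
  ~ (ball x e `<=` N).
Proof.
move=> mN N0 e0 xN.
have : (mu (ball x e) <= mu N)%E.
  by apply: le_measure => //; rewrite inE //; exact: measurable_ball.
rewrite N0 lebesgue_measure_ball ?(ltW e0) // lee_fin leNgt => /negP; apply.
by rewrite mulrn_wgt0.
Qed.

Lemma continuous_ae_eq f g : continuous f -> continuous g ->
  {ae mu, forall x, f x = g x} -> forall x, f x = g x.
Proof.
move=> cf cg [N [mN N0 fgN]] x; apply/eqP; rewrite -subr_eq0; apply/negPn/negP => fgx.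
have : {for x, continuous (fun y => f y - g y)} by apply: cvgB; [exact: cf|exact: cg].
move=> /cvgrPdist_lt /(_ `|f x - g x|); rewrite normr_gt0 => /(_ fgx).
move=> /nbhs_ballP[e /= e0 He].
apply: (null_set_ball mN N0 e0 (x := x)) => y /He h; apply: fgN => /= fgy.
by move: h; rewrite fgy subrr subr0 ltxx.
Qed.

Lemma ae_exists (P : R -> Prop) : {ae mu, forall x, P x} -> exists x, P x.
Proof.
move=> [N [mN N0 PN]]; apply: contrapT => nP.
apply: (null_set_ball mN N0 ltr01 (x := 0)) => y _.
by apply: PN => /= Py; apply: nP; exists y.
Qed.

(** Almost every point is a Lebesgue point, so one can be fixed as base and the increments measured
    from it. *)
Lemma weak_derivative_primitive f g : weak_derivative f g ->
  exists c, {ae mu, forall x, f x = c + primitive g x}.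
Proof.
move=> wfg; have [lf lg _] := wfg.
have aef := lebesgue_differentiation lf.
have [x0 fx0] := ae_exists aef.
exists (f x0 - primitive g x0); apply: (ae_imply _ aef) => x fx.
have [xx0|xx0|->] := ltgtP x x0.
- have := weak_derivative_lebesgue_pt wfg xx0 fx fx0.
  rewrite -(primitiveB lg (ltW xx0)) => e.
  by rewrite addrAC -addrA -[X in _ + X]opprB -e; ring.
- have := weak_derivative_lebesgue_pt wfg xx0 fx0 fx.
  rewrite -(primitiveB lg (ltW xx0)) => e.
  by rewrite addrAC -addrA -e; ring.
- by rewrite subrK.
Qed.

(** The continuous representative must be [c + primitive g], and this has derivative [g] at the
    Lebesgue points of [g]. It identifies the square integrable derivative supplied by H^1 with the
    classical one. *)
Lemma weak_derivative_classical f g F F' : weak_derivative f g ->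
  continuous F -> {ae mu, forall x, f x = F x} ->
  (forall x, has_derive F x (F' x)) -> {ae mu, forall x, g x = F' x}.
Proof.
move=> wfg cF fF dF; have [_ lg _] := wfg.
have [c fc] := weak_derivative_primitive wfg.
have FE : F = fun x => c + primitive g x.
  apply/funext; apply: continuous_ae_eq => //.
    by move=> x; apply: cvgD; [exact: cvg_cst|exact: continuous_primitive].
  by apply: (ae_imply2 _ fF fc) => x <- <-.
apply: (ae_imply _ (lebesgue_differentiation lg)) => x gx.
rewrite -(has_derive_derive1 (dF x)) FE; apply/esym/has_derive_derive1.
rewrite -[g x]add0r; apply: has_deriveD; first exact: has_derive_cst.
exact: has_derive_primitive_lebesgue_pt.
Qed.

(** Square integrability in the bounded-primitive form of [finite_energy]. *)
Lemma square_integrable_primitive f F : f \in Lfun mu 2%:E -> continuous F ->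
  {ae mu, forall x, f x = F x} ->
  exists H B, forall x, 0 <= x -> has_derive H x (F x ^+ 2) /\ H x <= B.
Proof.
move=> /Lfun2_integrable_sqr if2 cF fF.
have cF2 : continuous (fun x => F x ^+ 2).
  by move=> x; apply: (@cvgM _ _ _ _ F F); exact: cF.
exists (primitive (fun x => F x ^+ 2)), (\int[mu]_x (f x ^+ 2))%R => x x0.
split; first exact: (@has_derive_primitive (fun x => F x ^+ 2)).
rewrite /primitive (Rintegral_segment_ge _ x0) subr0.
have mf2 : measurable_fun setT (EFin \o (fun x => f x ^+ 2)).
  exact: (measurable_int mu if2).
have lF2 := continuous_locally_integrable cF2.
have e : (\int[mu]_(t in `[0%R, x]) (F t ^+ 2)%:E =
    \int[mu]_(t in `[0%R, x]) (f t ^+ 2)%:E)%E.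
  apply: ae_eq_integral => //.
  - exact: (measurable_int mu (locally_integrable_segment 0 x lF2)).
  - exact: measurable_funTS.
  - by apply: (ae_imply _ fF) => y ->.
rewrite /Rintegral e fine_le //.
- apply: (integrable_fin_num _ (integrableS _ _ _ if2)) => //.
- exact: (integrable_fin_num _ if2).
- by apply: ge0_subset_integral => // y _; rewrite lee_fin sqr_ge0.
Qed.

Lemma in_H1_primitives f F F' : in_H1 f -> continuous F -> continuous F' ->
  {ae mu, forall x, f x = F x} -> (forall x, has_derive F x (F' x)) ->
  exists H B, forall x, 0 <= x ->
    has_derive H x (F x ^+ 2 + F' x ^+ 2) /\ H x <= B.
Proof.
move=> [f2 [g g2 wfg]] cF cF' fF dF.
have gF' := weak_derivative_classical wfg cF fF dF.
have [H1 [B1 HB1]] := square_integrable_primitive f2 cF fF.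
have [H2 [B2 HB2]] := square_integrable_primitive g2 cF' gF'.
exists (fun x => H1 x + H2 x), (B1 + B2) => x x0.
have [d1 b1] := HB1 x x0; have [d2 b2] := HB2 x x0.
by split; [exact: has_deriveD|exact: lerD].
Qed.

End Primitive.

(** * Bound states as classical solutions *)

Section ComplexComponents.
Context {R : realType}.
Implicit Types (z : R[i]) (th om k ga G c d : R).

Lemma modulusE z : modulus z = amplitude (complex.Re z) (complex.Im z).
Proof. by rewrite /modulus normc_def. Qed.

(* lambda1 + i lambda2 = e^{-i th} (i om - k) *)
Definition lambda1 th om k : R := om * sin th - k * cos th.
Definition lambda2 th om k : R := om * cos th + k * sin th.

Lemma profile_equationE th om k ga G z z2 :
  ('i%C * om%:C * z = expi th * z2 + expi ga * G%:C * z + k%:C * z) <->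
  (complex.Re z2 = lambda1 th om k * complex.Re z - lambda2 th om k * complex.Im z -
     G * (cos (ga - th) * complex.Re z - sin (ga - th) * complex.Im z) /\
   complex.Im z2 = lambda2 th om k * complex.Re z + lambda1 th om k * complex.Im z -
     G * (sin (ga - th) * complex.Re z + cos (ga - th) * complex.Im z)).
Proof.
case: z => p q; case: z2 => p2 q2; rewrite /expi /lambda1 /lambda2 cosB sinB /=.
have cs := cos2Dsin2 th.
move: (cos th) (sin th) (cos ga) (sin ga) cs => c s cg sg cs.
simpc; split=> [[e1 e2]|[e1 e2]].
  (* Multiplication by [e^{-i th}] recovers [z2] from [e^{i th} z2]; [hp] and [hq] are its
     components. *)
  have hp : p2 = c * (c * p2 - s * q2) + s * (s * p2 + c * q2).
    by rewrite -[LHS]mul1r -cs; ring.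
  have hq : q2 = c * (s * p2 + c * q2) - s * (c * p2 - s * q2).
    by rewrite -[LHS]mul1r -cs; ring.
  have h1 : c * p2 - s * q2 = - (om * q) - (cg * G * p - sg * G * q) - k * p.
    by move: e1; lra.
  have h2 : s * p2 + c * q2 = om * p - (cg * G * q + sg * G * p) - k * q.
    by move: e2; lra.
  by split; [rewrite hp h1 h2|rewrite hq h1 h2]; ring.
have h1 : c * p2 - s * q2 = - (om * q) - (cg * G * p - sg * G * q) - k * p.
  rewrite e1 e2; transitivity ((c ^+ 2 + s ^+ 2) *
    (- (om * q) - (cg * G * p - sg * G * q) - k * p)); first by ring.
  by rewrite cs mul1r.
have h2 : s * p2 + c * q2 = om * p - (cg * G * q + sg * G * p) - k * q.
  rewrite e1 e2; transitivity ((c ^+ 2 + s ^+ 2) *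
    (om * p - (cg * G * q + sg * G * p) - k * q)); first by ring.
  by rewrite cs mul1r.
by congr Complex; move: h1 h2; lra.
Qed.

Lemma exists_angle c d : c ^+ 2 + d ^+ 2 = 1 ->
  exists2 t : R, - pi <= t <= pi & cos t = c /\ sin t = d.
Proof.
move=> cd; have c1 : -1 <= c <= 1.
  rewrite -ler_norml -(@ler_pXn2r _ 2) ?nnegrE // expr1n real_normK ?num_real //.
  by rewrite -cd lerDl sqr_ge0.
have sc : Num.sqrt (1 - c ^+ 2) = `|d|.
  by rewrite -cd addrAC subrr add0r sqrtr_sqr.
have a0 := acos_ge0 c1; have api := acos_lepi c1.
have [d0|/ltW d0] := leP 0 d.
  exists (acos c); first by rewrite api andbT (le_trans _ a0) // oppr_le0 pi_ge0.
  by rewrite acosK ?in_itv //= sin_acos // sc ger0_norm.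
exists (- acos c).
  by rewrite lerN2 api /= (le_trans _ (pi_ge0 R)) // oppr_le0.
by rewrite cosN sinN acosK ?in_itv //= sin_acos // sc ler0_norm // opprK.
Qed.

Lemma lambda_norm th om k :
  lambda1 th om k ^+ 2 + lambda2 th om k ^+ 2 = om ^+ 2 + k ^+ 2.
Proof.
rewrite /lambda1 /lambda2.
transitivity ((om ^+ 2 + k ^+ 2) * (cos th ^+ 2 + sin th ^+ 2)); first by ring.
by rewrite cos2Dsin2 mulr1.
Qed.

(** If the sum vanished, then [l = - r] and [k - i om = - e^{i th} l = r e^{i th}], whose principal
    argument is [th] because [th] lies between [- pi / 2] and [pi / 2]. *)
Lemma arg_spectral_gap th om k : - (pi / 2) < th < pi / 2 ->
  om ^+ 2 + k ^+ 2 != 0 -> arg (k%:C - 'i%C * om%:C) != th ->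
  0 < Num.sqrt (lambda1 th om k ^+ 2 + lambda2 th om k ^+ 2) + lambda1 th om k.
Proof.
move=> /andP[th1 th2] ok0; rewrite lt_def.
set r := Num.sqrt _.
have rr : r ^+ 2 = lambda1 th om k ^+ 2 + lambda2 th om k ^+ 2.
  by rewrite sqr_sqrtr // addr_ge0 ?sqr_ge0.
have r0 : 0 <= r by exact: sqrtr_ge0.
have rgt0 : 0 < r.
  rewrite lt_def r0 andbT; apply: contra ok0 => /eqP rz.
  by rewrite -(lambda_norm th) -rr rz expr0n.
have lr : - lambda1 th om k <= r.
  apply: le_trans (ler_norm _) _.
  rewrite normrN -(@ler_pXn2r _ 2) ?nnegrE // real_normK ?num_real // rr.
  by rewrite lerDl sqr_ge0.
rewrite -lerBlDr sub0r lr andbT; apply: contra => /eqP rl.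
have l1 : lambda1 th om k = - r by move: rl; lra.
have l2 : lambda2 th om k = 0.
  by apply/eqP; rewrite -sqrf_eq0; apply/eqP; move: rr; rewrite l1 sqrrN; lra.
have cs := cos2Dsin2 th.
have kE : k = r * cos th.
  transitivity (k * (cos th ^+ 2 + sin th ^+ 2)); first by rewrite cs mulr1.
  transitivity (lambda2 th om k * sin th - lambda1 th om k * cos th).
    by rewrite /lambda1 /lambda2; ring.
  by rewrite l1 l2; ring.
have oE : om = - (r * sin th).
  transitivity (om * (cos th ^+ 2 + sin th ^+ 2)); first by rewrite cs mulr1.
  transitivity (lambda2 th om k * cos th + lambda1 th om k * sin th).
    by rewrite /lambda1 /lambda2; ring.
  by rewrite l1 l2; ring.
rewrite /arg modulusE; simpc; rewrite /= oE kE opprK.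
have -> : amplitude (r * cos th) (r * sin th) = r.
  rewrite /amplitude !exprMn -mulrDr cs mulr1 sqrtr_sqr ger0_norm //.
have -> : r * cos th / r = cos th by field; rewrite gt_eqF.
rewrite pmulr_rge0 //.
have pi0 := pi_gt0 R.
have [s0|s0] := leP 0 (sin th).
  have th0 : 0 <= th.
    rewrite leNgt; apply/negP => th0.
    have : 0 < sin (- th) by apply: sin_gt0_pi; rewrite oppr_gt0 th0 /=; lra.
    by rewrite sinN oppr_gt0 ltNge s0.
  by rewrite cosK // in_itv /= th0 /=; lra.
have th0 : th < 0.
  rewrite ltNge; apply/negP => th0; move: s0; rewrite ltNge => /negP; apply.
  by apply: sin_ge0_pi; rewrite th0 /=; lra.
rewrite -cosN cosK ?opprK // in_itv /= oppr_ge0 (ltW th0) /=; lra.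
Qed.

End ComplexComponents.

(** * Regularity of profiles and the uniqueness statement *)

Section ProfileRegularity.
Context {R : realType}.
Local Notation mu := (@lebesgue_measure R).

Lemma continuous_powR_ge0 (f : R -> R) (sigma : R) : 0 < sigma ->
  (forall x, 0 <= f x) -> continuous f -> continuous (fun x => f x `^ sigma).
Proof.
move=> s0 f0 cf x; have [fx0|fx0] := eqVneq (f x) 0; last first.
  have fx : 0 < f x by rewrite lt_def fx0 f0.
  apply: (@continuous_comp _ _ _ f (fun y => y `^ sigma)); first exact: cf.
  apply: differentiable_continuous; apply/derivable1_diffP.
  by apply: derivable_powR; rewrite in_itv /= fx.
apply/cvgrPdist_le => /= e e0; rewrite fx0 powR0 ?gt_eqF //.
(* At a zero of [f] the power need not be derivable; the tolerance [e^(1/sigma)] for [f] becomes [e]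
   for its power. *)
have := cf x => /cvgrPdist_le /(_ (e `^ sigma^-1) (powR_gt0 _ e0)).
apply: filterS => y; rewrite fx0 !sub0r !normrN !ger0_norm ?powR_ge0 // => h.
apply: (@le_trans _ _ ((e `^ sigma^-1) `^ sigma)).
  by rewrite ge0_ler_powR ?nnegrE ?powR_ge0 // ltW.
by rewrite -powRrM mulVf ?gt_eqF // powRr1 // ltW.
Qed.

Lemma continuous_amplitude_powR (p q : R -> R) (sigma : R) : 0 < sigma ->
  continuous p -> continuous q ->
  continuous (fun x => amplitude (p x) (q x) `^ sigma).
Proof.
move=> s0 cp cq; apply: continuous_powR_ge0 => // x; first exact: amplitude_ge0.
apply: (@continuous_comp _ _ _ (fun x => p x ^+ 2 + q x ^+ 2) Num.sqrt).
  apply: cvgD; [apply: (@cvgM _ _ _ _ p p)|apply: (@cvgM _ _ _ _ q q)];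
  by [exact: cp|exact: cq].
exact: sqrt_continuous.
Qed.

(** Half-open intervals determine the measure. Translation invariance lets almost-everywhere
    equalities pass to the argument [x - x0]. *)
Lemma lebesgue_measure_shift (c : R) (A : set R) : measurable A ->
  pushforward mu (fun x => x + c : measurableTypeR R) A = mu A.
Proof.
move=> mA; apply/esym/lebesgue_measure_unique => //=.
  exact: measurable_funD.
move=> _ _ [[a b]] _ <-; rewrite /pushforward.
have -> : (fun x => x + c) @^-1` `]a, b] = `]a - c, b - c]%classic.
  by apply/seteqP; split => x /=; rewrite !in_itv /= ltrBlDr lerBrDr.
rewrite !lebesgue_measure_itv /= !lte_fin ltrD2r.
by case: ifP => // _; rewrite -!EFinB; congr EFin; ring.
Qed.

Lemma ae_shift (P : R -> Prop) (c : R) : {ae mu, forall x, P x} ->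
  {ae mu, forall x, P (x + c)}.
Proof.
move=> [N [mN N0 PN]]; exists ((fun x => x + c) @^-1` N); split.
- rewrite -[X in measurable X]setTI.
  have mc : measurable_fun [set: R] (fun x : R => x + c) by exact: measurable_funD.
  exact: mc.
- by rewrite -N0 -(lebesgue_measure_shift c mN).
- by move=> x /= nP; apply: PN.
Qed.

(** A priori [phi2] is only locally integrable. By the equation it equals almost everywhere a
    continuous function of the representative of [phi], so its primitive is C^1 and the system holds
    at every point. *)
Lemma bound_state_profile_system (sigma theta omega k gamma : R) (phi : R -> R[i]) :
  0 < sigma -> bound_state_profile sigma theta omega k gamma phi ->
  exists p q p' q' : R -> R,
    [/\ profile_system sigma (lambda1 theta omega k) (lambda2 theta omega k)
          (cos (gamma - theta)) (sin (gamma - theta)) p q p' q',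
        finite_energy p q p' q'
      & {ae mu, forall x, phi x = p x +i* q x}].
Proof.
move=> s0 [[H1p H1q] [phi1 [phi2 [[wp wq] [wp1 wq1] eqn]]]].
have [cp pE] := weak_derivative_primitive wp.
have [cq qE] := weak_derivative_primitive wq.
have [cp1 p1E] := weak_derivative_primitive wp1.
have [cq1 q1E] := weak_derivative_primitive wq1.
have [_ lp1 _] := wp; have [_ lq1 _] := wq.
have [_ lp2 _] := wp1; have [_ lq2 _] := wq1.
pose p x := cp + primitive (fun x => complex.Re (phi1 x)) x.
pose q x := cq + primitive (fun x => complex.Im (phi1 x)) x.
pose p' x := cp1 + primitive (fun x => complex.Re (phi2 x)) x.
pose q' x := cq1 + primitive (fun x => complex.Im (phi2 x)) x.
have cprim (c : R) f : locally_integrable [set: R] f ->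
    continuous (fun x => c + primitive f x).
  by move=> lf x; apply: cvgD; [exact: cvg_cst|exact: continuous_primitive].
have [cp_ cq_] : continuous p /\ continuous q by split; exact: cprim.
have [cp' cq'] : continuous p' /\ continuous q' by split; exact: cprim.
have dprim (c : R) f F : locally_integrable [set: R] f -> continuous F ->
    {ae mu, forall x, f x = F x} ->
    forall x, has_derive (fun x => c + primitive f x) x (F x).
  move=> lf cF fF x; rewrite (eq_primitive_ae lf (continuous_locally_integrable cF) fF).
  rewrite -[F x]add0r; apply: has_deriveD; first exact: has_derive_cst.
  exact: has_derive_primitive.
have phiE : {ae mu, forall x, phi x = p x +i* q x}.
  apply: (ae_imply2 _ pE qE) => x; rewrite /p /q.
  by case: (phi x) => a b /= -> ->.
pose G x := amplitude (p x) (q x) `^ sigma.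
have cG : continuous G by exact: continuous_amplitude_powR.
pose W1 x := lambda1 theta omega k * p x - lambda2 theta omega k * q x -
  G x * (cos (gamma - theta) * p x - sin (gamma - theta) * q x).
pose W2 x := lambda2 theta omega k * p x + lambda1 theta omega k * q x -
  G x * (sin (gamma - theta) * p x + cos (gamma - theta) * q x).
have cM (c : R) (f : R -> R) : continuous f -> continuous (fun x => c * f x : R).
  by move=> cf x; apply: cvgM; [exact: cvg_cst|exact: cf].
have cD (f g : R -> R) : continuous f -> continuous g ->
    continuous (fun x : R => f x + g x : R).
  by move=> cf cg x; apply: cvgD; [exact: cf|exact: cg].
have cB (f g : R -> R) : continuous f -> continuous g ->
    continuous (fun x : R => f x - g x : R).
  by move=> cf cg x; apply: cvgB; [exact: cf|exact: cg].
have cGM (f : R -> R) : continuous f -> continuous (fun x : R => G x * f x).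
  by move=> cf x; apply: cvgM; [exact: cG|exact: cf].
have cW1 : continuous W1.
  by apply: (cB); [apply: (cB); exact: (cM)|apply: (cGM); apply: (cB); exact: (cM)].
have cW2 : continuous W2.
  by apply: (cB); [apply: (cD); exact: (cM)|apply: (cGM); apply: (cD); exact: (cM)].
have W12 : {ae mu, forall x, complex.Re (phi2 x) = W1 x /\ complex.Im (phi2 x) = W2 x}.
  apply: (ae_imply2 _ phiE eqn) => x phix /profile_equationE.
  by rewrite modulusE phix.
have dp x : has_derive p x (p' x) by exact: (dprim _ _ p').
have dq x : has_derive q x (q' x) by exact: (dprim _ _ q').
exists p, q, p', q'; split => //.
- move=> x; split => //.
  + by apply: (dprim _ _ W1) => //; apply: (ae_imply _ W12) => y [].
  + by apply: (dprim _ _ W2) => //; apply: (ae_imply _ W12) => y [].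
- have [H1 [B1 HB1]] := in_H1_primitives H1p cp_ cp' pE dp.
  have [H2 [B2 HB2]] := in_H1_primitives H1q cq_ cq' qE dq.
  exists (fun x => H1 x + H2 x), (B1 + B2) => x x0.
  have [d1 b1] := HB1 x x0; have [d2 b2] := HB2 x x0.
  split; last exact: lerD.
  by derive_tac; rewrite /energy; ring.
Qed.

Theorem bound_state_profile_uniq (sigma theta omega k gamma : R) :
  0 < sigma -> - (pi / 2) < theta < pi / 2 -> omega ^+ 2 + k ^+ 2 != 0 ->
  arg (k%:C - 'i%C * omega%:C) != theta ->
  forall phi1 phi2 : R -> R[i],
    bound_state_profile sigma theta omega k gamma phi1 -> nontrivial phi1 ->
    bound_state_profile sigma theta omega k gamma phi2 -> nontrivial phi2 ->
    exists rho x0 : R, {ae mu, forall x, phi2 x = expi rho * phi1 (x - x0)}.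
Proof.
move=> s0 th ok0 argN phi1 phi2 b1 nt1 b2 nt2.
have [p [q [p' [q' [ode1 fe1 e1]]]]] := bound_state_profile_system s0 b1.
have [s [t [s' [t' [ode2 fe2 e2]]]]] := bound_state_profile_system s0 b2.
have nz phi (u v : R -> R) : nontrivial phi ->
    {ae mu, forall x, phi x = u x +i* v x} -> ~ (forall x, u x = 0 /\ v x = 0).
  move=> nt e uv0; apply: nt; apply: (ae_imply _ e) => x ->.
  by have [-> ->] := uv0 x.
have [c [d [x0 [cd st]]]] := profile_system_unique_up_to_symmetry s0
  (arg_spectral_gap th ok0 argN) ode1 ode2 fe1 fe2 (nz _ _ _ nt1 e1) (nz _ _ _ nt2 e2).
have [rho _ [rhoc rhos]] := exists_angle cd.
exists rho, x0; apply: (ae_imply2 _ e2 (ae_shift (- x0) e1)) => x -> ->.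
by have [-> ->] := st x; rewrite /expi rhoc rhos; simpc; congr Complex; ring.
Qed.

End ProfileRegularity.

(** * Classical functions in the Sobolev space *)

Section ClassicalWeakDerivative.
Context {R : realType}.
Local Notation mu := (@lebesgue_measure R).
Implicit Types (f g : R -> R) (x c K M : R).

Lemma classical_weak_derivative f f' : (forall x, has_derive f x (f' x)) ->
  continuous f' -> weak_derivative f f'.
Proof.
move=> df cf'; have cf : continuous f by move=> x; exact: has_derive_continuous (df x).
split; try exact: continuous_locally_integrable.
move=> eta [deta [M HM]].
have d0 x : has_derive eta x (derive1 eta x) by exact/derivable_has_derive/(deta 0%N).
have ceta : continuous eta by move=> x; exact: has_derive_continuous (d0 x).
have ceta' : continuous (derive1 eta).
  by move=> x; exact: has_derive_continuous (derivable_has_derive (deta 1%N x)).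
(* [eta] is known to vanish only for [|x| > M], and [M] may be negative; this larger bound makes it
   vanish at both endpoints, which removes the boundary terms. *)
pose N := `|M| + 1.
have N0 : 0 < N by rewrite ltr_wpDl.
have MN : M < N by rewrite (le_lt_trans (ler_norm _)) // ltrDl.
have eta0 x : ~~ (- N < x < N) -> eta x = 0.
  move=> xN; apply: HM; apply: (lt_le_trans MN).
  by rewrite leNgt ltr_norml.
have deta0 x : ~~ (- N <= x <= N) -> derive1 eta x = 0.
  rewrite negb_and -!ltNge => xN; apply: has_derive_derive1.
  apply: (near_eq_is_derive _ (has_derive_cst x 0)).
  case/orP : xN => xN; [move: (lt_nbhsl xN)|move: (lt_nbhsr xN)].
    by apply: filterS => y yN; rewrite eta0 // negb_and -leNgt (ltW yN).
  by apply: filterS => y yN; rewrite eta0 // negb_and -!leNgt (ltW yN) orbT.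
rewrite (@Rintegral_support _ _ (- N) N); last first.
  by move=> x /deta0 ->; rewrite mulr0.
rewrite (@Rintegral_support _ (fun x => f' x * eta x) (- N) N); last first.
  move=> x xN; rewrite eta0 ?mulr0 //; apply: contra xN => /andP[h1 h2].
  by rewrite !ltW.
have NN : - N < N by rewrite gtrN.
have LR h (h' : R -> R) : (forall x, has_derive h x (h' x)) ->
    derivable_oo_LRcontinuous h (- N) N.
  move=> dh; have ch : continuous h by move=> x; exact: has_derive_continuous (dh x).
  split; [|exact/cvg_at_right_filter/ch|exact/cvg_at_left_filter/ch].
  by move=> x _; exact: has_derive_derivable (dh x).
rewrite (@Rintegration_by_parts R f eta f' (derive1 eta)) //.
- rewrite [eta N]eta0 ?ltxx ?andbF // [eta (- N)]eta0 ?ltxx //.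
  by rewrite !mulr0 subrr sub0r.
- exact: continuous_subspaceT.
- exact: LR df.
- by move=> x _; exact: has_derive_derive1.
- exact: continuous_subspaceT.
- exact: LR d0.
Qed.

Lemma integral_expRN_abs_lty c : 0 < c ->
  (\int[mu]_x (expR (- (c * `|x|)))%:E < +oo)%E.
Proof.
move=> c0; rewrite ge0_symfun_integralT; first last.
- by move=> x; rewrite /= normrN.
- move=> x; apply: (@continuous_comp _ _ _ (fun y => - (c * `|y|)) expR).
    by apply: cvgN; apply: cvgM; [exact: cvg_cst|exact: norm_continuous].
  exact: continuous_expR.
- by move=> x; exact: expR_ge0.
have -> : [set x : R | 0 <= x] = `[0, +oo[%classic.
  by apply/seteqP; split => x /=; rewrite in_itv /= andbT.
have -> : (\int[mu]_(x in `[0%R, +oo[) (expR (- (c * `|x|)))%:E =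
   \int[mu]_(x in `[0%R, +oo[) (expR (- (c * x)))%:E)%E.
  apply: eq_integral => x; rewrite inE /= in_itv /= andbT => x0.
  by rewrite ger0_norm.
have dF x : has_derive (fun y => - (c^-1 * expR (- (c * y)))) x (expR (- (c * x))).
  by derive_tac; field; rewrite gt_eqF.
have cF : continuous (fun y => - (c^-1 * expR (- (c * y)))).
  by move=> x; exact: has_derive_continuous (dF x).
rewrite (@ge0_continuous_FTC2y R (fun x => expR (- (c * x)))
   (fun y => - (c^-1 * expR (- (c * y)))) 0 0).
- by rewrite -EFinB -EFinM ltry.
- by move=> x _; exact: expR_ge0.
- apply: continuous_subspaceT => x.
  have d2 : has_derive (fun y => expR (- (c * y))) x (expR (- (c * x)) * - c).
    by derive_tac; ring.
  exact: has_derive_continuous d2.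
- rewrite -oppr0; apply: cvgN; rewrite -(mulr0 c^-1); apply: cvgM; first exact: cvg_cst.
  apply: (@cvg_comp _ _ _ (fun y => c * y) (fun y => expR (- y))); last first.
    exact: cvgr_expR.
  exact: gt0_cvgMry.
- by move=> x _; exact: has_derive_derivable (dF x).
- exact/cvg_at_right_filter/cF.
- by move=> x _; exact: has_derive_derive1.
Qed.

Lemma Lfun2_exp_decay f c K : 0 < c -> continuous f ->
  (forall x, `|f x| <= K * expR (- (c * `|x|))) -> f \in Lfun mu 2%:E.
Proof.
move=> c0 cf fK; have mf := continuous_measurable_fun cf.
have K0 : 0 <= K.
  have := le_trans (normr_ge0 _) (fK 0).
  by rewrite normr0 mulr0 oppr0 expR0 mulr1.
rewrite inE; apply/andP; split; first by rewrite inE.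
rewrite inE /= /finite_norm unlock /=.
apply: poweR_lty.
have -> : (\int[mu]_x (`|(f x)%:E| `^ 2) = \int[mu]_x (f x ^+ 2)%:E)%E.
  by apply: eq_integral => x _; rewrite /= powR_mulrn // real_normK ?num_real.
have cexp : continuous (fun x => expR (- (2 * c * `|x|))).
  move=> x; apply: (@continuous_comp _ _ _ (fun y => - (2 * c * `|y|)) expR).
    by apply: cvgN; apply: cvgM; [exact: cvg_cst|exact: norm_continuous].
  exact: continuous_expR.
have mexp := continuous_measurable_fun cexp.
apply: (@le_lt_trans _ _
    (\int[mu]_x ((K ^+ 2)%:E * (expR (- (2 * c * `|x|)))%:E))%E).
  apply: ge0_le_integral => //=.
  - by move=> x _; rewrite lee_fin sqr_ge0.
  - by apply/measurable_EFinP; exact: measurable_funX.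
  - by apply: measurable_funeM; exact/measurable_EFinP.
  - move=> x _; rewrite -EFinM lee_fin.
    have -> : expR (- (2 * c * `|x|)) = expR (- (c * `|x|)) ^+ 2.
      by rewrite -expRM_natl; congr expR; ring.
    rewrite -exprMn -(real_normK (num_real (f x))).
    by rewrite ler_pXn2r ?nnegrE // mulr_ge0 // expR_ge0.
rewrite ge0_integralZl ?lee_fin ?sqr_ge0 //; last first.
  exact/measurable_EFinP.
apply: lte_mul_pinfty => //; first by rewrite lee_fin sqr_ge0.
by apply: integral_expRN_abs_lty; rewrite mulr_gt0.
Qed.

Lemma in_H1_exp_decay f f' c K : 0 < c -> (forall x, has_derive f x (f' x)) ->
  continuous f' ->
  (forall x, `|f x| <= K * expR (- (c * `|x|))) ->
  (forall x, `|f' x| <= K * expR (- (c * `|x|))) -> in_H1 f.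
Proof.
move=> c0 df cf' fK f'K; split.
  apply: Lfun2_exp_decay c0 _ fK => x; exact: has_derive_continuous (df x).
exists f'; first exact: Lfun2_exp_decay c0 cf' f'K.
exact: classical_weak_derivative.
Qed.

End ClassicalWeakDerivative.

(** * Explicit bound states *)

Section Soliton.
Context {R : realType} (sigma : R).
Hypothesis sigma_gt0 : 0 < sigma.
Implicit Types (x y A B d : R).

Let ch y : R := (expR (sigma / 2 * y) + expR (- (sigma / 2 * y))) / 2.
Let sh y : R := (expR (sigma / 2 * y) - expR (- (sigma / 2 * y))) / 2.

Let ch_gt0 y : 0 < ch y.
Proof. by rewrite divr_gt0 // addr_gt0 ?expR_gt0. Qed.

Let has_derive_ch y : has_derive ch y (sigma / 2 * sh y).
Proof. by rewrite /ch /sh; derive_tac; field. Qed.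

Let has_derive_sh y : has_derive sh y (sigma / 2 * ch y).
Proof. by rewrite /ch /sh; derive_tac; field. Qed.

Let ch2Bsh2 y : ch y ^+ 2 - sh y ^+ 2 = 1.
Proof.
rewrite /ch /sh; transitivity (expR (sigma / 2 * y) * expR (- (sigma / 2 * y))).
  by field.
by rewrite expRxMexpNx_1.
Qed.

(* [soliton_slope] is tanh(sigma y / 2) and [ln_soliton] is the logarithm of
   ((sigma + 2) / 2)^(1/sigma) cosh(sigma y / 2)^(-2/sigma). *)
Definition soliton_slope y : R := sh y / ch y.

Definition ln_soliton y : R := sigma^-1 * ln ((sigma + 2) / 2) - 2 / sigma * ln (ch y).

Definition soliton y : R := expR (ln_soliton y).

Lemma has_derive_ln_soliton y : has_derive ln_soliton y (- soliton_slope y).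
Proof.
have dln : has_derive (fun x => ln (ch x)) y ((ch y)^-1 * (sigma / 2 * sh y)).
  by apply: has_derive_comp; [exact: is_derive1_ln|exact: has_derive_ch].
rewrite /ln_soliton; derive_tac; rewrite /soliton_slope; field.
by rewrite !gt_eqF.
Qed.

Lemma has_derive_soliton_slope y :
  has_derive soliton_slope y (sigma / 2 * (1 - soliton_slope y ^+ 2)).
Proof.
have dV : has_derive (fun x => (ch x)^-1) y (- (sigma / 2 * sh y) * (ch y)^-1 ^+ 2).
  by apply: has_deriveV; [rewrite gt_eqF|exact: has_derive_ch].
have dsh := has_derive_sh y.
rewrite /soliton_slope; derive_tac; field.
by rewrite gt_eqF.
Qed.

Lemma soliton_slope_le1 y : `|soliton_slope y| <= 1.
Proof.
rewrite normrM normfV ler_pdivrMr ?normr_gt0 ?gt_eqF // mul1r.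
rewrite -(@ler_pXn2r _ 2) ?nnegrE // !real_normK ?num_real //.
by have := ch2Bsh2 y; lra.
Qed.

(** This is [sech^2 = 1 - tanh^2]. The nonlinearity becomes a polynomial in the slope, and the
    differential equations become polynomial identities. *)
Lemma soliton_powR y :
  soliton y `^ sigma = (sigma + 2) / 2 * (1 - soliton_slope y ^+ 2).
Proof.
have s2 : 0 < (sigma + 2) / 2 by rewrite divr_gt0 // addr_gt0.
rewrite -expRM.
have -> : ln_soliton y * sigma = ln ((sigma + 2) / 2) - ln (ch y) *+ 2.
  by rewrite /ln_soliton; field; rewrite gt_eqF.
rewrite -lnXn // expRB !lnK ?posrE ?exprn_gt0 //.
have -> : 1 - soliton_slope y ^+ 2 = (ch y ^+ 2 - sh y ^+ 2) / ch y ^+ 2.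
  by rewrite /soliton_slope; field; rewrite gt_eqF.
by rewrite ch2Bsh2 mul1r.
Qed.

Lemma soliton_even y : soliton (- y) = soliton y.
Proof.
rewrite /soliton /ln_soliton; congr (expR (_ - _ * ln _)).
by rewrite /ch mulrN opprK addrC.
Qed.

(** From [2 cosh z >= exp |z|] at [z = sigma y / 2], raised to the power [- 2 / sigma]; the rate is
    then exactly 1. *)
Lemma soliton_exp_decay : exists K : R, forall y, soliton y <= K * expR (- `|y|).
Proof.
exists (expR (sigma^-1 * ln ((sigma + 2) / 2) + 2 / sigma * ln 2)) => y.
rewrite -expRD ler_expR /ln_soliton -addrA lerD2l.
have -> : 2 / sigma * ln 2 - `|y| = - (2 / sigma * (sigma / 2 * `|y| - ln 2)).
  by field; rewrite gt_eqF.
rewrite lerN2 ler_wpM2l ?divr_ge0 ?(ltW sigma_gt0) //.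
rewrite lerBlDr -ler_expR expRD !lnK ?posrE //.
rewrite /ch divfK //.
have [y0|/ltW y0] := leP 0 y.
  by rewrite ger0_norm // lerDl expR_ge0.
by rewrite ler0_norm // mulrN lerDr expR_ge0.
Qed.

(* psi exp(i d ln psi) for psi(x) = A soliton(B x) *)
Let lpsi A B x : R := ln A + ln_soliton (B * x).
Let wave_re A B d x : R := expR (lpsi A B x) * cos (d * lpsi A B x).
Let wave_im A B d x : R := expR (lpsi A B x) * sin (d * lpsi A B x).
Let wave_re' A B d x : R :=
  - (B * soliton_slope (B * x)) * (wave_re A B d x - d * wave_im A B d x).
Let wave_im' A B d x : R :=
  - (B * soliton_slope (B * x)) * (wave_im A B d x + d * wave_re A B d x).

Let has_derive_lpsi A B x : has_derive (lpsi A B) x (- (B * soliton_slope (B * x))).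
Proof.
have dBx : has_derive (fun x => B * x) x B by derive_tac; ring.
have dl := has_derive_comp (has_derive_ln_soliton (B * x)) dBx.
by rewrite /lpsi; derive_tac; ring.
Qed.

Let has_derive_wave A B d x :
  has_derive (wave_re A B d) x (wave_re' A B d x) /\
  has_derive (wave_im A B d) x (wave_im' A B d x).
Proof.
have dl := has_derive_lpsi A B x.
by split; rewrite /wave_re /wave_im; derive_tac;
  rewrite /wave_re' /wave_im' /wave_re /wave_im; ring.
Qed.

(** In complex form, [phi' = - B tau (1 + i d) phi], and differentiating again gives [phi'' = B^2
    (tau^2 (1 + i d)^2 - sigma / 2 (1 - tau^2) (1 + i d)) phi]. *)
Let has_derive_wave' A B d x (tau := soliton_slope (B * x)) :
  has_derive (wave_re' A B d) x
    (B ^+ 2 * ((tau ^+ 2 - sigma / 2 * (1 - tau ^+ 2)) *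
       (wave_re A B d x - d * wave_im A B d x) -
       tau ^+ 2 * d * (wave_im A B d x + d * wave_re A B d x))) /\
  has_derive (wave_im' A B d) x
    (B ^+ 2 * ((tau ^+ 2 - sigma / 2 * (1 - tau ^+ 2)) *
       (wave_im A B d x + d * wave_re A B d x) +
       tau ^+ 2 * d * (wave_re A B d x - d * wave_im A B d x))).
Proof.
have dBx : has_derive (fun x => B * x) x B by derive_tac; ring.
have dt := has_derive_comp (has_derive_soliton_slope (B * x)) dBx.
have [dp dq] := has_derive_wave A B d x.
split; [rewrite /wave_re'|rewrite /wave_im']; derive_tac;
  by rewrite /wave_re' /wave_im' /tau; ring.
Qed.

Lemma nls_bound_state_soliton : nls_bound_state sigma soliton.
Proof.
have dl y := has_derive_ln_soliton y; have dt y := has_derive_soliton_slope y.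
have dQ y : has_derive soliton y (- (soliton_slope y * soliton y)).
  by have dly := dl y; rewrite /soliton; derive_tac; ring.
have dQ' y : has_derive (fun y => - (soliton_slope y * soliton y)) y
    (soliton y - soliton y `^ (sigma + 1)).
  have dty := dt y; have dQy := dQ y; derive_tac.
  rewrite powRD; last by apply/implyP => _; rewrite gt_eqF ?expR_gt0.
  by rewrite powRr1 ?expR_ge0 // soliton_powR; field.
have Q'E : derive1 soliton = fun y => - (soliton_slope y * soliton y).
  by apply/funext => y; exact: has_derive_derive1.
have [K HK] := soliton_exp_decay.
have HK1 y : soliton y <= K * expR (- (1 * `|y|)) by rewrite mul1r.
split.
- by move=> x; exact: expR_gt0.
- exact: soliton_even.
- apply: (@in_H1_exp_decay _ soliton _ 1 K _ dQ) => // [x|x|x].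
  + exact: has_derive_continuous (dQ' x).
  + by rewrite ger0_norm // expR_ge0.
  + rewrite normrN normrM (@ger0_norm _ (soliton x)) ?expR_ge0 //.
    by apply: le_trans (HK1 x); rewrite ler_piMl ?expR_ge0 // soliton_slope_le1.
- by move=> x; rewrite Q'E; split; [exact: has_derive_derivable (dQ x)|
    exact: has_derive_derivable (dQ' x)].
- move=> x; rewrite /derive1n /= Q'E; exact: has_derive_derive1.
Qed.

(** With tau the slope, [phi'' / phi = B^2 (1 + i d)^2 - B^2 (1 - tau^2) (1 + i d) (sigma + 2 + 2 i
    d) / 2], while [|phi|^sigma = A^sigma (sigma + 2) (1 - tau^2) / 2]. The hypotheses match
    coefficients: [sigma + 2 - 2 d^2] and [d (sigma + 4)] are the real and imaginary parts of
    [(1 + i d) (sigma + 2 + 2 i d)]. *)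
Lemma bound_state_profile_soliton_wave (A B d theta omega k gamma : R) :
  0 < A -> 0 < B ->
  lambda1 theta omega k = B ^+ 2 * (1 - d ^+ 2) ->
  lambda2 theta omega k = 2 * d * B ^+ 2 ->
  A `^ sigma * (sigma + 2) * cos (gamma - theta) =
    B ^+ 2 * (sigma + 2 - 2 * d ^+ 2) ->
  A `^ sigma * (sigma + 2) * sin (gamma - theta) = B ^+ 2 * (d * (sigma + 4)) ->
  bound_state_profile sigma theta omega k gamma (fun x =>
    (A * soliton (B * x))%:C * expi (d * ln (A * soliton (B * x)))).
Proof.
move=> A0 B0 l1E l2E cE sE.
have psiE x : expR (lpsi A B x) = A * soliton (B * x).
  by rewrite /lpsi expRD lnK ?posrE.
have -> : (fun x => (A * soliton (B * x))%:C * expi (d * ln (A * soliton (B * x)))) =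
    (fun x => wave_re A B d x +i* wave_im A B d x).
  apply/funext => x; rewrite -psiE expRK /expi /wave_re /wave_im; simpc.
  by [].
have dw x := has_derive_wave A B d x; have dw' x := has_derive_wave' A B d x.
have dBx x : has_derive (fun x => B * x) x B by derive_tac; ring.
have dt x := has_derive_comp (has_derive_soliton_slope (B * x)) (dBx x).
set w2re := fun x => B ^+ 2 * ((soliton_slope (B * x) ^+ 2 -
  sigma / 2 * (1 - soliton_slope (B * x) ^+ 2)) *
  (wave_re A B d x - d * wave_im A B d x) -
  soliton_slope (B * x) ^+ 2 * d * (wave_im A B d x + d * wave_re A B d x)).
set w2im := fun x => B ^+ 2 * ((soliton_slope (B * x) ^+ 2 -
  sigma / 2 * (1 - soliton_slope (B * x) ^+ 2)) *
  (wave_im A B d x + d * wave_re A B d x) +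
  soliton_slope (B * x) ^+ 2 * d * (wave_re A B d x - d * wave_im A B d x)).
have cw1re : continuous (wave_re' A B d).
  by move=> x; have [h _] := dw' x; exact: has_derive_continuous h.
have cw1im : continuous (wave_im' A B d).
  by move=> x; have [_ h] := dw' x; exact: has_derive_continuous h.
have cw2re : continuous w2re.
  move=> x; have [h1 h2] := dw x; have h3 := dt x.
  by apply: (@has_derive_continuous _ _ _ _); rewrite /w2re; derive_rules.
have cw2im : continuous w2im.
  move=> x; have [h1 h2] := dw x; have h3 := dt x.
  by apply: (@has_derive_continuous _ _ _ _); rewrite /w2im; derive_rules.
have [K HK] := soliton_exp_decay.
have K0 : 0 <= K.
  have := HK 0; rewrite normr0 oppr0 expR0 mulr1; apply: le_trans; exact: expR_ge0.
pose psi x := expR (lpsi A B x).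
have psi0 x : 0 <= psi x by exact: expR_ge0.
have psiK x : psi x <= A * K * expR (- (B * `|x|)).
  rewrite /psi psiE -mulrA ler_wpM2l ?(ltW A0) //.
  by apply: le_trans (HK _) _; rewrite normrM (ger0_norm (ltW B0)).
have reK x : `|wave_re A B d x| <= psi x.
  by rewrite /wave_re normrM ger0_norm // ler_piMr // cos_max.
have imK x : `|wave_im A B d x| <= psi x.
  by rewrite /wave_im normrM ger0_norm // ler_piMr // sin_max.
(* The 1 serves [phi] and [B (1 + |d|)] serves [phi'], the slope being at most 1 in absolute
   value. *)
pose C := 1 + B * (1 + `|d|).
have C1 : 1 <= C by rewrite lerDl mulr_ge0 ?addr_ge0 ?(ltW B0).
have bnd (f : R -> R) : (forall x, `|f x| <= C * psi x) ->
    forall x, `|f x| <= C * (A * K) * expR (- (B * `|x|)).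
  move=> fC x; apply: le_trans (fC x) _; rewrite -mulrA ler_wpM2l //.
  by rewrite (le_trans _ C1).
have bnd0 (f : R -> R) : (forall x, `|f x| <= psi x) -> forall x, `|f x| <= C * psi x.
  by move=> fp x; apply: le_trans (fp x) _; rewrite ler_peMl.
have slope_bnd x u v : `|u| <= psi x -> `|v| <= psi x ->
    `|- (B * soliton_slope (B * x)) * (u + v * d)| <= C * psi x.
  move=> up vp; rewrite normrM normrN normrM (ger0_norm (ltW B0)).
  apply: (@le_trans _ _ (B * (psi x + psi x * `|d|))).
    apply: ler_pM => //; first by rewrite mulr_ge0 // ltW.
      by rewrite ler_piMr ?(ltW B0) // soliton_slope_le1.
    apply: le_trans (ler_normD _ _) _; rewrite lerD // normrM.
    by rewrite ler_wpM2r.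
  have -> : B * (psi x + psi x * `|d|) = B * (1 + `|d|) * psi x by ring.
  by rewrite ler_wpM2r // /C lerDr.
have re'K x : `|wave_re' A B d x| <= C * psi x.
  have -> : wave_re' A B d x =
      - (B * soliton_slope (B * x)) * (wave_re A B d x + - wave_im A B d x * d).
    by rewrite /wave_re'; ring.
  by apply: slope_bnd; rewrite ?normrN.
have im'K x : `|wave_im' A B d x| <= C * psi x.
  have -> : wave_im' A B d x =
      - (B * soliton_slope (B * x)) * (wave_im A B d x + wave_re A B d x * d).
    by rewrite /wave_im'; ring.
  exact: slope_bnd.
have H1re : in_H1 (wave_re A B d).
  apply: (in_H1_exp_decay B0 (f' := wave_re' A B d) (K := C * (A * K))).
  - exact: (fun x => (dw x).1).
  - exact: cw1re.
  - exact: (bnd _ (bnd0 _ reK)).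
  - exact: (bnd _ re'K).
have H1im : in_H1 (wave_im A B d).
  apply: (in_H1_exp_decay B0 (f' := wave_im' A B d) (K := C * (A * K))).
  - exact: (fun x => (dw x).2).
  - exact: cw1im.
  - exact: (bnd _ (bnd0 _ imK)).
  - exact: (bnd _ im'K).
split; first by split; [exact: H1re|exact: H1im].
exists (fun x => wave_re' A B d x +i* wave_im' A B d x),
  (fun x => w2re x +i* w2im x); split.
- split; first exact: (classical_weak_derivative (fun x => (dw x).1) cw1re).
  exact: (classical_weak_derivative (fun x => (dw x).2) cw1im).
- split; first exact: (classical_weak_derivative (fun x => (dw' x).1) cw2re).
  exact: (classical_weak_derivative (fun x => (dw' x).2) cw2im).
- apply: aeW => x; apply/profile_equationE; rewrite modulusE /=.
  have -> : amplitude (wave_re A B d x) (wave_im A B d x) = A * soliton (B * x).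
    rewrite -psiE /amplitude /wave_re /wave_im !exprMn -mulrDr cos2Dsin2 mulr1.
    by rewrite sqrtr_sqr ger0_norm ?expR_ge0.
  rewrite powRM ?expR_ge0 ?(ltW A0) // soliton_powR l1E l2E.
  have cE' : A `^ sigma * ((sigma + 2) / 2) * cos (gamma - theta) =
    B ^+ 2 * (sigma + 2 - 2 * d ^+ 2) / 2 by rewrite -cE; field.
  have sE' : A `^ sigma * ((sigma + 2) / 2) * sin (gamma - theta) =
    B ^+ 2 * (d * (sigma + 4)) / 2 by rewrite -sE; field.
  rewrite /w2re /w2im; move: (soliton_slope (B * x)) => tau.
  move: (wave_re A B d x) (wave_im A B d x) => p q.
  have e1 : A `^ sigma * ((sigma + 2) / 2 * (1 - tau ^+ 2)) *
      (cos (gamma - theta) * p - sin (gamma - theta) * q) = (1 - tau ^+ 2) *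
      (A `^ sigma * ((sigma + 2) / 2) * cos (gamma - theta) * p -
       A `^ sigma * ((sigma + 2) / 2) * sin (gamma - theta) * q) by ring.
  have e2 : A `^ sigma * ((sigma + 2) / 2 * (1 - tau ^+ 2)) *
      (sin (gamma - theta) * p + cos (gamma - theta) * q) = (1 - tau ^+ 2) *
      (A `^ sigma * ((sigma + 2) / 2) * sin (gamma - theta) * p +
       A `^ sigma * ((sigma + 2) / 2) * cos (gamma - theta) * q) by ring.
  by rewrite e1 e2 cE' sE'; split; field.
Qed.

End Soliton.

(** * The parameters gamma, d, A and B *)

Section Gamma.
Context {R : realType}.
Implicit Types (sigma theta omega k d gamma t : R).

(** [cos (s - t) = 1] makes the sine of the half-difference vanish, and for [t <= s] the
    half-difference lies in [0, pi[. *)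
Lemma cos_sin_inj (s t : R) : cos s = cos t -> sin s = sin t ->
  `|s - t| < pi *+ 2 -> s = t.
Proof.
wlog st : s t / t <= s => [hw|] ec es h.
  have [/hw|/ltW st] := leP t s; first exact.
  by apply/esym/hw => //; rewrite distrC.
apply/eqP; rewrite eq_le st andbT leNgt; apply/negP => ts.
have : sin ((s - t) / 2) ^+ 2 = 0.
  have : cos (s - t) = 1 by rewrite cosB ec es -!expr2 cos2Dsin2.
  rewrite [X in cos X](_ : s - t = ((s - t) / 2) *+ 2); last by field.
  rewrite cos_mulr2n; have := cos2Dsin2 ((s - t) / 2); lra.
move=> /eqP; rewrite sqrf_eq0; apply/negP; rewrite gt_eqF //.
rewrite ger0_norm ?subr_ge0 // in h.
by apply: sin_gt0_pi; apply/andP; split; lra.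
Qed.

(* e^{i (gamma - theta)} = (X + i Y) / n *)
Let X sigma d := sigma + 2 - 2 * d ^+ 2.
Let Y sigma d := d * (sigma + 4).
Let n sigma d : R := Num.sqrt (X sigma d ^+ 2 + Y sigma d ^+ 2).

(** This is [Re ((1 - i d) (X + i Y))], where [X + i Y = (1 + i d) (sigma + 2 + 2 i d)]. Its sign
    shows that [X + i Y] is nonzero and that the inequality on [gamma] selects this direction and
    not the opposite one. *)
Lemma tangent_direction_gt0 sigma d : 0 < sigma -> 0 < d * Y sigma d + X sigma d.
Proof.
move=> s0; have -> : d * Y sigma d + X sigma d = (sigma + 2) * (1 + d ^+ 2).
  by rewrite /X /Y; ring.
have d1 : 0 < 1 + d ^+ 2 by rewrite ltr_pwDl // sqr_ge0.
by rewrite mulr_gt0 // addr_gt0.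
Qed.

Lemma tangent_norm_gt0 sigma d : 0 < sigma -> 0 < n sigma d.
Proof.
move=> s0; rewrite sqrtr_gt0 lt_def addr_ge0 ?sqr_ge0 // andbT.
rewrite paddr_eq0 ?sqr_ge0 // !sqrf_eq0; apply/negP => /andP[/eqP X0 /eqP Y0].
by have := tangent_direction_gt0 d s0; rewrite X0 Y0 mulr0 addr0 ltxx.
Qed.

Lemma is_gammaP sigma theta d gamma : 0 < sigma ->
  is_gamma sigma theta d gamma <->
  [/\ - pi < gamma <= pi, cos (gamma - theta) = X sigma d / n sigma d
    & sin (gamma - theta) = Y sigma d / n sigma d].
Proof.
move=> s0; have n0 := tangent_norm_gt0 d s0; have dir := tangent_direction_gt0 d s0.
have nn : n sigma d ^+ 2 = X sigma d ^+ 2 + Y sigma d ^+ 2.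
  by rewrite sqr_sqrtr // addr_ge0 ?sqr_ge0.
rewrite /is_gamma /tangent_equation -/(X sigma d) -/(Y sigma d).
move: (X sigma d) (Y sigma d) (n sigma d) n0 dir nn => x y m m0 dir mm.
set t := gamma - theta; have cs := cos2Dsin2 t.
have m20 : m ^+ 2 != 0 by rewrite expf_neq0 // gt_eqF.
split => [[gpi te pos]|[gpi ct st]]; last first.
  split => //; rewrite ct st.
    case: ifPn => [_|x0]; first by ring.
    rewrite /tan ct st mulf_neq0 ?invr_neq0 ?(gt_eqF m0) //; split => //.
    by field; rewrite x0 (gt_eqF m0).
  have -> : d * (y / m) + x / m = (d * y + x) / m by ring.
  by rewrite divr_gt0.
(* Both branches of the tangent equation say that [(cos t, sin t)] is parallel to [(x, y)]. *)
have te' : x * sin t = y * cos t.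
  move: te; case: ifPn => [//|x0 [c0]]; rewrite /tan => /eqP.
  by rewrite eqr_div // mulrC => /eqP ->.
(* The coefficient of the projection onto [(x, y)]: positive by the sign condition, hence [1 / m] by
   normalization. *)
pose s := (x * cos t + y * sin t) / m ^+ 2.
have cE : cos t = s * x.
  have -> : s * x = (x * (x * cos t) + y * (x * sin t)) / m ^+ 2.
    by rewrite /s; ring.
  have -> : x * (x * cos t) + y * (x * sin t) = cos t * m ^+ 2.
    by rewrite te' mm; ring.
  by rewrite mulfK.
have sE : sin t = s * y.
  have -> : s * y = (x * (y * cos t) + y * (y * sin t)) / m ^+ 2.
    by rewrite /s; ring.
  have -> : x * (y * cos t) + y * (y * sin t) = sin t * m ^+ 2.
    by rewrite -te' mm; ring.
  by rewrite mulfK.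
have sgt0 : 0 < s.
  have e : d * sin t + cos t = s * (d * y + x) by rewrite {1}cE {1}sE; ring.
  by move: pos; rewrite e pmulr_lgt0.
have sm : s = m^-1.
  apply/eqP; rewrite -(@eqrXn2 _ 2) ?invr_ge0 ?(ltW m0) ?(ltW sgt0) //.
  apply/eqP; rewrite exprVn -[RHS]mul1r -cs cE sE.
  have -> : (s * x) ^+ 2 + (s * y) ^+ 2 = s ^+ 2 * (x ^+ 2 + y ^+ 2) by ring.
  by rewrite -mm mulfK.
by split => //; rewrite -/t ?cE ?sE sm mulrC.
Qed.

(** Since [t0] is in [- pi, pi] and [theta] within [pi / 2] of 0, at most one shift by 2 pi brings
    [t0 + theta] into ]- pi, pi]. Two values in that interval differ by less than 2 pi, whence
    uniqueness. *)
Lemma exists_unique_gamma sigma theta d : 0 < sigma ->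
  - (pi / 2) < theta < pi / 2 -> exists! gamma : R, is_gamma sigma theta d gamma.
Proof.
move=> s0 /andP[th1 th2]; have n0 := tangent_norm_gt0 d s0.
have pi0 := pi_gt0 R.
have [t0 /andP[t1 t2] [ct st]] : exists2 t : R, - pi <= t <= pi &
    cos t = X sigma d / n sigma d /\ sin t = Y sigma d / n sigma d.
  apply: exists_angle; rewrite !expr_div_n -mulrDl.
  have nn : n sigma d ^+ 2 = X sigma d ^+ 2 + Y sigma d ^+ 2.
    by rewrite sqr_sqrtr // addr_ge0 ?sqr_ge0.
  by rewrite -nn divff // expf_neq0 // gt_eqF.
have [gamma gpi [cg sg]] : exists2 gamma : R, - pi < gamma <= pi &
    cos (gamma - theta) = cos t0 /\ sin (gamma - theta) = sin t0.
  have [h1|h1] := ltP pi (t0 + theta).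
    exists (t0 + theta - pi *+ 2); first by apply/andP; split; lra.
    rewrite (_ : _ - theta = t0 - pi *+ 2); last by ring.
    by rewrite -(cosD2pi (t0 - _)) -(sinD2pi (t0 - _)) subrK.
  have [h2|h2] := leP (t0 + theta) (- pi).
    exists (t0 + theta + pi *+ 2); first by apply/andP; split; lra.
    rewrite (_ : _ - theta = t0 + pi *+ 2); last by ring.
    by rewrite cosD2pi sinD2pi.
  by exists (t0 + theta); [rewrite h2|rewrite addrK].
exists gamma; split; first by apply/is_gammaP; rewrite ?cg ?sg.
move=> gamma' /(is_gammaP _ _ _ s0)[/andP[g1 g2] cg' sg'].
have : gamma - theta = gamma' - theta.
  apply: cos_sin_inj; rewrite ?cg ?sg ?cg' ?sg' //.
  move: gpi => /andP[g3 g4]; rewrite ltr_norml; apply/andP; split; lra.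
by move/addIr.
Qed.

(* l = e (1 + i d)^2 *)
Lemma dcoef_spec theta omega k (d := dcoef theta omega k) :
  omega * cos theta + k * sin theta != 0 ->
  exists2 e : R, 0 < e & lambda1 theta omega k = e * (1 - d ^+ 2) /\
    lambda2 theta omega k = 2 * d * e.
Proof.
rewrite -/(lambda2 theta omega k) => l20.
have rr := lambda_norm theta omega k.
have dE : d = (Num.sqrt (omega ^+ 2 + k ^+ 2) - lambda1 theta omega k) /
    lambda2 theta omega k.
  by rewrite /d /dcoef /lambda1 /lambda2; congr (_ / _); ring.
rewrite dE -rr; set l1 := lambda1 _ _ _ in rr dE *.
set l2 := lambda2 _ _ _ in l20 rr dE *.
set r := Num.sqrt _.
have r2 : r ^+ 2 = l1 ^+ 2 + l2 ^+ 2 by rewrite sqr_sqrtr // addr_ge0 ?sqr_ge0.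
have r0 : 0 <= r by exact: sqrtr_ge0.
have l2sq : 0 < l2 ^+ 2 by rewrite lt_def sqrf_eq0 l20 sqr_ge0.
have rl : `|l1| < r.
  rewrite -(@ltr_pXn2r _ 2) ?nnegrE // real_normK ?num_real // r2.
  by rewrite ltrDl.
have e0 : 0 < (r + l1) / 2.
  rewrite divr_gt0 // -ltrBlDr sub0r (le_lt_trans _ rl) //.
  by rewrite -normrN ler_norm.
have l2E : l2 ^+ 2 = (r - l1) * (r + l1).
  by rewrite -(addKr (l1 ^+ 2) (l2 ^+ 2)) -r2; ring.
(* [l = e (1 + i d)^2] forces [e (1 + d^2) = r] and [e (1 - d^2) = l1], whose half-sum is [e]. *)
exists ((r + l1) / 2) => //; split.
  have rl1 : r + l1 != 0 by apply: contraTneq e0 => ->; rewrite mul0r ltxx.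
  have rl2 : r - l1 != 0.
    by rewrite subr_eq0 gt_eqF // (le_lt_trans (ler_norm _)).
  rewrite expr_div_n l2E; field.
  by rewrite rl1 rl2.
transitivity (l2 ^+ 2 / l2); first by field.
by rewrite l2E; field.
Qed.

Lemma exists_soliton_wave sigma theta omega k gamma (d := dcoef theta omega k) :
  0 < sigma -> omega * cos theta + k * sin theta != 0 ->
  is_gamma sigma theta d gamma ->
  exists A B : R, [/\ 0 < A, 0 < B & bound_state_profile sigma theta omega k gamma
    (fun x => (A * soliton sigma (B * x))%:C *
       expi (d * ln (A * soliton sigma (B * x))))].
Proof.
move=> s0 l20 /(is_gammaP _ _ _ s0)[_ ct st].
have [e e0 [l1E l2E]] := dcoef_spec l20; have n0 := tangent_norm_gt0 d s0.
(* [a] is [A^sigma], found by taking moduli in [A^sigma (sigma + 2) m = e (X + i Y)] with [|m| = 1]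
   and [B^2 = e]. *)
pose a := n sigma d * e / (sigma + 2).
have a0 : 0 < a by rewrite divr_gt0 ?mulr_gt0 // addr_gt0.
have As : (a `^ sigma^-1) `^ sigma = a.
  by rewrite -powRrM mulVf ?gt_eqF // powRr1 // ltW.
have Bs : Num.sqrt e ^+ 2 = e by rewrite sqr_sqrtr // ltW.
have aE : a * (sigma + 2) = n sigma d * e by rewrite divfK // gt_eqF // addr_gt0.
exists (a `^ sigma^-1), (Num.sqrt e); split.
- exact: powR_gt0.
- by rewrite sqrtr_gt0.
apply: bound_state_profile_soliton_wave; rewrite ?powR_gt0 ?sqrtr_gt0 ?Bs ?As ?aE //.
- by rewrite ct -/(X sigma d); field; rewrite gt_eqF.
- by rewrite st -/(Y sigma d); field; rewrite gt_eqF.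
Qed.

End Gamma.

Theorem theorem1p10 (R : realType) (sigma theta : R)
    (sigma_gt0 : 0 < sigma) (theta_bnd : - (pi / 2) < theta < pi / 2) :
  (forall omega k gamma : R,
     - pi < gamma <= pi ->
     omega ^+ 2 + k ^+ 2 != 0 ->
     arg (k%:C - 'i%C * omega%:C) != theta ->
     forall phi1 phi2 : R -> R[i],
       bound_state_profile sigma theta omega k gamma phi1 -> nontrivial phi1 ->
       bound_state_profile sigma theta omega k gamma phi2 -> nontrivial phi2 ->
       exists rho x0 : R,
         {ae @lebesgue_measure R, forall x,
            phi2 x = expi rho * phi1 (x - x0)})
  /\
  (forall omega k : R,
     omega * cos theta + k * sin theta != 0 ->
     let d := dcoef theta omega k in
     (exists! gamma : R, is_gamma sigma theta d gamma) /\
     (forall gamma : R, is_gamma sigma theta d gamma ->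
        exists phi : R -> R[i], exists psi : R -> R,
          [/\ bound_state_profile sigma theta omega k gamma phi,
              nontrivial phi,
              forall x, 0 < psi x,
              forall x, phi x = (psi x)%:C * expi (d * ln (psi x))
            & exists Q : R -> R, nls_bound_state sigma Q /\
                exists A B : R, [/\ 0 < A, 0 < B
                  & forall x, psi x = A * Q (B * x)]])).
Proof.
split=> [omega k gamma _ ok0 argN|omega k l20 d].
  exact: bound_state_profile_uniq.
split=> [|gamma hgamma]; first exact: exists_unique_gamma.
have [A [B [A0 B0 wave]]] := exists_soliton_wave sigma_gt0 l20 hgamma.
have psi0 x : 0 < A * soliton sigma (B * x) by rewrite mulr_gt0 // expR_gt0.
eexists; exists (fun x => A * soliton sigma (B * x)); split => //.
- exact: wave.
- move=> /ae_exists[x] /eqP; rewrite mulf_eq0 => /orP[] /eqP.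
    by move=> [] /eqP; rewrite gt_eqF.
  move=> [c0 s1]; have := cos2Dsin2 (d * ln (A * soliton sigma (B * x))).
  by rewrite c0 s1 expr0n /= addr0 => /esym/eqP; rewrite oner_eq0.
- exists (soliton sigma); split; first exact: nls_bound_state_soliton.
  by exists A, B.
Qed.
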